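(* Let $(X,T)$ be a dynamical system such that the entropy map $h:M_T(X)\to\mathbb{R}$ is upper semi-continuous (for the weak-$*$ topology). Then the set of potentials $\phi\in C(X)$ that freeze is dense in $C(X)$ with the uniform topology.
   Context: A dynamical system $(X,T)$ consists of a compact metric space $X$ and a continuous action $T=\{T_g\}_{g\in G}$ of a topological (semi)group $G$ on $X$ (continuous maps $T_g:X\to X$ with $T_g\circ T_h=T_{gh}$). $M_T(X)$ is the set of $T$-invariant Borel probability measures on $X$, with the weak-$*$ topology. Standing assumptions: $M_T(X)\neq\emptyset$; a measure-theoretic (Kolmogorov-Sinai) entropy $h(\mu)$ is defined for every $\mu\in M_T(X)$ (as is the case when $G$ is amenable), and $h:M_T(X)\to\mathbb{R}$ is non-negative and affine; and the topological entropy $h(X)=\sup\{h(\mu):\mu\in M_T(X)\}$ is finite. $C(X)$ is the space of real-valued continuous functions (potentials) on $X$. The pressure of $\phi\in C(X)$ is $P(\phi)=\sup\{h(\mu)+\int\phi\,d\mu:\mu\in M_T(X)\}$, and $\mu\in M_T(X)$ is an equilibrium state for $\phi$ if $P(\phi)=h(\mu)+\int\phi\,d\mu$. A potential $\phi$ freezes at $\mu\in M_T(X)$ if there exists $\beta_0>0$ such that for all $\beta\ge\beta_0$, $\mu$ is an equilibrium state for $\beta\phi$; $\phi$ freezes if it freezes at some $\mu\in M_T(X)$. *)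

(* Defs.v *)
From HB Require Import structures.
From mathcomp Require Import all_boot all_order all_algebra.
From mathcomp Require Import all_classical all_reals all_analysis.

Set Implicit Arguments.
Unset Strict Implicit.
Unset Printing Implicit Defensive.

Import Order.TTheory GRing.Theory Num.Theory.
Import numFieldNormedType.Exports.

Local Open Scope classical_set_scope.
Local Open Scope ring_scope.

(* The library's measurable types are pointed, so the phase space is a pointed
   metric space.  The point plays no other role; a phase space carrying a
   probability measure is nonempty anyway. *)
#[short(type="pmetricType")]
HB.structure Definition PointedMetric (R : numDomainType) :=
  {X of Metric R X & isPointed X}.

(* No unit is required, so topological groups and monoids are covered. *)
HB.mixin Record isTopologicalSemigroup G & Topological G & Semigroup G := {
  mulg_continuous : continuous (fun p : G * G => (p.1 * p.2)%g)
}.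

#[short(type="topSemigroupType")]
HB.structure Definition TopologicalSemigroup :=
  {G of Topological G & Semigroup G & isTopologicalSemigroup G}.

Section potentials.
Context {R : realType}.

Definition potential (X : pmetricType R) : Type := continuousType X R.

(* The topology of uniform convergence on C(X). *)
HB.instance Definition _ (X : pmetricType R) :=
  PseudoMetric.copy (potential X)
    (initial_topology (fun phi : continuousType X R =>
       (phi : X -> R) : arrow_uniform_type X R)).

End potentials.

Section borel_probabilities.
Context {R : realType}.

Definition borel (X : pmetricType R) := g_sigma_algebraType (@open X).

Definition borel_probability (X : pmetricType R) : Type :=
  probability (borel X) R.

HB.instance Definition _ (X : pmetricType R) :=
  Choice.copy (borel_probability X) (probability (borel X) R).

Definition integral_against (X : pmetricType R) (mu : borel_probability X) :
  {ptws potential X -> R} := fun phi => \int[mu]_x phi x.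

(* The weak-* topology: the coarsest one making mu |-> \int phi dmu continuous
   for every continuous phi. *)
HB.instance Definition _ (X : pmetricType R) :=
  Topological.copy (borel_probability X)
    (initial_topology (@integral_against X)).

End borel_probabilities.

Section dynamical_systems.
Context {R : realType} {X : pmetricType R} {G : topSemigroupType}.

Definition dynamical_system (T : G -> X -> X) : Prop :=
  [/\ compact [set: X],
      forall g, continuous (T g)
    & forall g h, T g \o T h = T (g * h)%g].

Definition invariant_under (T : G -> X -> X) : set (borel_probability X) :=
  [set mu | forall g (A : set (borel X)), measurable A ->
              mu (T g @^-1` A) = mu A].

(* M_T(X); as a [set_type] it carries the subspace topology. *)
Definition invariant_measure (T : G -> X -> X) : topologicalType :=
  set_type (invariant_under T).

Definition prob_of (T : G -> X -> X) (mu : invariant_measure T) :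
  probability (borel X) R := set_val mu.

End dynamical_systems.

Definition upper_semicontinuous {R : realType} {M : topologicalType}
    (f : M -> R) : Prop :=
  lower_semicontinuous (fun x => (- f x)%:E).

Section thermodynamic_formalism.
Context {R : realType} {X : pmetricType R} {G : topSemigroupType}.
Context {T : G -> X -> X}.
Implicit Types (h : invariant_measure T -> R) (phi : X -> R).
Implicit Types mu nu rho : invariant_measure T.

(* The convex combination rho = t mu + (1 - t) nu is expressed on Borel sets
   because the library's measures also take (meaningless) values on
   nonmeasurable sets. *)
Definition affine h : Prop :=
  forall (t : R) mu nu rho, 0 <= t <= 1 ->
    (forall A : set (borel X), measurable A ->
       prob_of rho A = t%:E * prob_of mu A + (1 - t)%:E * prob_of nu A)%E ->
    h rho = t * h mu + (1 - t) * h nu.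

Definition topological_entropy h : \bar R :=
  ereal_sup [set (h mu)%:E | mu in [set: invariant_measure T]].

Definition pressure h phi : \bar R :=
  ereal_sup [set (h mu + \int[prob_of mu]_x phi x)%:E
            | mu in [set: invariant_measure T]].

Definition equilibrium_state h phi mu : Prop :=
  pressure h phi = (h mu + \int[prob_of mu]_x phi x)%:E.

Definition freezes_at h phi mu : Prop :=
  exists2 beta0 : R, 0 < beta0 &
    forall beta, beta0 <= beta ->
      equilibrium_state h (fun x => beta * phi x) mu.

Definition freezes h phi : Prop := exists mu, freezes_at h phi mu.

End thermodynamic_formalism.

(* Main.v *)
(* Maximize [f] at an extreme point [mu] of the compact convex set of invariant
   measures.  A perturbation [g] of [f] freezes at [mu] as soon as
     mean nu g + max 0 (s * (h nu - h mu)) <= mean mu g   for all nu,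
   and the largest violation of this inequality, the excess, is at most
   [s * sup h] at [f].  While the excess is positive, every measure realizing it
   is singular to [mu]: the infimum of two invariant measures is invariant, so a
   nonsingular [nu] would have [mu] as a convex component, and the two affine
   competitors vanish at [mu].  A minimax argument then yields a continuous [g0] in
   [0, 1] with mean close to 1 for [mu] and close to 0 on all these measures;
   adding a small multiple of [2 g0 - 1] lowers the excess at a definite rate per
   unit of uniform distance.  By Ekeland's principle the excess vanishes within
   distance [2 s * sup h] of [f]. *)

Require Import Defs.
From HB Require Import structures.
From mathcomp Require Import all_boot all_order all_algebra.
From mathcomp Require Import all_classical all_reals all_analysis.
From mathcomp Require Import measurable_realfun ring lra.

Set Implicit Arguments.
Unset Strict Implicit.
Unset Printing Implicit Defensive.

Import Order.TTheory GRing.Theory Num.Theory.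
Import numFieldNormedType.Exports.
Local Open Scope classical_set_scope.
Local Open Scope ring_scope.

(** * Borel measures on metric spaces *)

(** Freezing at [mu] asks that [h nu - h mu <= beta * (mean mu g - mean nu g)] for every large
    [beta]. A measure of larger entropy than [mu] calls for a gap in the means proportional to the
    entropy difference; for any other measure a nonnegative gap is enough. The maximum with 0
    encodes both demands, and [beta0 = 1 / s] then works for all [nu] together. The obstacle is that
    this maximum is convex but not affine in [nu], so the measures of largest excess need not form a
    convex set, as the minimax argument requires. It is however the larger of two affine upper
    semi-continuous functions, whose top level sets are closed and convex; a peak function is built
    for each, and the minimum of the two serves both. The length of a descent step comes from a
    compactness argument and has no lower bound uniform in the potential. Only the ratio of decrease
    to distance is controlled, which is why a single step, or a fixed number of them, does not
    suffice and a variational principle takes over. *)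

Section continuous_integrals.
Context {R : realType} {X : pmetricType R}.
Implicit Types (f g : X -> R) (mu : {measure set (borel X) -> \bar R}).

Lemma borel_open (U : set (borel X)) : @open X U -> measurable U.
Proof. exact: sub_sigma_algebra. Qed.

Lemma borel_closed (F : set (borel X)) : @closed X F -> measurable F.
Proof.
move=> cF; rewrite -(setCK F); apply: measurableC; apply: borel_open.
exact: closed_openC.
Qed.

Lemma continuous_borel_measurable f :
  continuous f -> measurable_fun [set: borel X] (f : borel X -> R).
Proof.
move=> cf; apply: (measurability _ (RGenOpens.measurableE R)).
move=> _ [_ [a [b ->]] <-]; rewrite setTI; apply: borel_open.
by move/continuousP : cf; apply; exact: interval_open.
Qed.

Lemma continuous_compact_bounded f : compact [set: X] -> continuous f ->
  exists2 c : R, 0 <= c & forall x, `|f x| <= c.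
Proof.
move=> cX cf.
have /compact_bounded[c [_ /(_ (`|c| + 1))]] : compact (f @` setT).
  by apply: continuous_compact => //; exact: continuous_subspaceT.
rewrite (le_lt_trans (ler_norm c))?ltrDl// => /(_ erefl) cP.
exists (`|c| + 1); first by rewrite addr_ge0.
by move=> x; apply: cP; exists x.
Qed.

Lemma continuous_integrable mu f : compact [set: X] -> (mu setT < +oo)%E ->
  continuous f -> mu.-integrable [set: borel X] (EFin \o f).
Proof.
move=> cX mufin cf; apply: measurable_bounded_integrable => //.
  exact: continuous_borel_measurable.
have [c c0 fc] := continuous_compact_bounded cX cf.
exists c; split; first exact: num_real.
by move=> d cd x _; apply: le_trans (fc x) _; exact: ltW.
Qed.

End continuous_integrals.

(** * Regularity of finite Borel measures *)

Section borel_regularity.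
Context {R : realType} {X : pmetricType R}.
Implicit Types (mu nu : {measure set (borel X) -> \bar R}).

Definition sandwiched mu (A : set (borel X)) := forall e : R, 0 < e ->
  exists F U : set X, [/\ closed F, open U, F `<=` A, A `<=` U
    & (mu (U `\` F : set (borel X)) < e%:E)%E].

Lemma sandwichedC mu A : sandwiched mu A -> sandwiched mu (~` A).
Proof.
move=> sA e e0; have [F [U [cF oU FA AU UF]]] := sA _ e0.
exists (~` U), (~` F); split.
- exact: open_closedC.
- exact: closed_openC.
- exact: subsetC.
- exact: subsetC.
- by rewrite (_ : ~` F `\` ~` U = U `\` F)// !setDE setCK setIC.
Qed.

Lemma nonincreasing_measure_lt mu (F : (set (borel X))^nat) (e : R) :
  (mu setT < +oo)%E -> (forall n, measurable (F n)) -> nonincreasing_seq F ->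
  (mu (\bigcap_n F n) < e%:E)%E -> exists n, (mu (F n) < e%:E)%E.
Proof.
move=> mufin mF dF Fe; apply/not_existsP => h.
have mu0 : (mu (F 0%N) < +oo)%E.
  by apply: le_lt_trans mufin; apply: le_measure; rewrite ?inE.
have cF := nonincreasing_cvg_mu mu0 mF (bigcapT_measurable mF) dF.
move: Fe; rewrite ltNge => /negP; apply.
have <- := cvg_lim (@ereal_hausdorff R) cF.
apply: lime_ge; first by apply/cvg_ex; eexists; exact: cF.
by apply: nearW => n /=; rewrite leNgt; exact/negP/h.
Qed.

Lemma open_exhaustion (U : set X) : open U -> exists F : (set X)^nat,
  [/\ forall n, closed (F n), forall n, F n `<=` U, nondecreasing_seq F
    & forall x, U x -> exists n, F n x].
Proof.
(* [F n] keeps the points that stay about [1 / (n + 1)] away from the complement of [U]. Taking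
   interiors of the balls makes the removed union open. *)
move=> oU; exists (fun n => ~` \bigcup_(y in ~` U) (ball y (n.+1%:R^-1 : R))^°).
split.
- move=> n; apply: open_closedC; apply: bigcup_open => y _.
  exact: open_interior.
- move=> n x /= Fx; apply: contrapT => Ux; apply: Fx; exists x => //.
  exact: nbhsx_ballx.
- move=> m n mn; apply/subsetPset; apply: subsetC => x [y Uy yx]; exists y => //.
  by apply: interiorS yx; apply: le_ball; rewrite lef_pV2 ?posrE// ler_nat.
- move=> x Ux; have [r /= r0 rU] : nbhs_ball x U.
    by rewrite nbhs_ballE; exact: open_nbhs_nbhs.
  have [n] := ltr_add_invr (y := 0) (x := r) r0.
  rewrite add0r => nr; exists n => -[y Uy yx]; apply: Uy.
  have /ball_sym {}yx := interior_subset yx.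
  by apply: rU; exact: le_ball (ltW nr) _ yx.
Qed.

Lemma open_sandwiched mu (U : set X) : (mu setT < +oo)%E -> open U ->
  sandwiched mu U.
Proof.
move=> mufin oU e e0; have [F [cF FU ndF FP]] := open_exhaustion oU.
have [|||n] := @nonincreasing_measure_lt mu (fun n => U `\` F n) e mufin.
- by move=> n; apply: measurableD; [exact: borel_open|exact: borel_closed].
- move=> m n mn; apply/subsetPset => x [Ux Fx]; split => // Fmx; apply: Fx.
  by have /subsetPset := ndF _ _ mn; apply.
- rewrite (_ : \bigcap_n _ = set0) ?measure0//.
  apply/seteqP; split => // x UFx; have [/FP[n Fn] _] := UFx 0%N I.
  by have [_] := UFx n I.
- by move=> Fn; exists (F n), U; split.
Qed.

Lemma bigcup_sandwiched mu (A : (set (borel X))^nat) : (mu setT < +oo)%E ->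
  (forall n, measurable (A n)) ->
  (forall n, sandwiched mu (A n)) -> sandwiched mu (\bigcup_n A n).
Proof.
move=> mufin mA sA e e0.
have e20 : 0 < e / 2 by rewrite divr_gt0.
have en0 (n : nat) : 0 < e / 2 / (2 ^ n.+1)%:R.
  by rewrite divr_gt0// ltr0n expn_gt0.
have /choice[F /choice[U FU]] := fun n => sA n _ (en0 n).
have mU n : measurable (U n : set (borel X)).
  by have [_ /borel_open] := FU n.
have mF n : measurable (F n : set (borel X)).
  by have [/borel_closed] := FU n.
(* Infinite unions of closed sets need not be closed, so the inner set uses only finitely many
   [F k]. The sets [G n] decrease to a subset of the union of the [U k \ F k], whose measure is at
   most [e / 2]; continuity from above then gives a finite [n]. *)
pose G (n : nat) : set (borel X) :=
  (\bigcup_k U k) `\` (\bigcup_(k in `I_n) F k).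
have cF n : closed (\bigcup_(k in `I_n) F k).
  by apply: closed_bigcup => [|k _]; [exact: finite_II|have [] := FU k].
have oU : open (\bigcup_k U k) by apply: bigcup_open => k _; have [] := FU k.
have mUF k : measurable (U k `\` F k : set (borel X)) by exact: measurableD.
have [|||n] := @nonincreasing_measure_lt mu G e mufin.
- by move=> n; apply: measurableD; [exact: borel_open|exact: borel_closed].
- move=> m n mn; apply/subsetPset => x [Ux Fx]; split => // -[k /= km Fk].
  by apply: Fx; exists k => //=; exact: leq_trans mn.
- apply: (@le_lt_trans _ _ (e / 2)%:E); last first.
    by rewrite lte_fin ltr_pdivrMr// ltr_pMr// ltr1n.
  apply: (@le_trans _ _ (mu (\bigcup_k (U k `\` F k)))).
    apply: le_measure; rewrite ?inE.
    - apply: bigcapT_measurable => n.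
      by apply: measurableD; [exact: borel_open|exact: borel_closed].
    - exact: bigcupT_measurable.
    - move=> x Gx; have [[k _ Ukx] _] := Gx 0%N I.
      exists k => //; split => // Fkx.
      by have [_] := Gx k.+1 I; apply; exists k => /=.
  have mB := bigcupT_measurable _ mUF.
  apply: (le_trans (@le_mu_bigcup _ _ _ mu _ mUF mB)).
  apply: le_trans (epsilon_trick0 xpredT (ltW e20)).
  by apply: lee_nneseries => // n _; apply: ltW; have [] := FU n.
- move=> Gn; exists (\bigcup_(k in `I_n) F k), (\bigcup_k U k); split => //.
    by move=> x [k _ Fkx]; exists k => //; have [_ _ + _ _] := FU k; apply.
  by move=> x [k _ Akx]; exists k => //; have [_ _ _ + _] := FU k; apply.
Qed.

Lemma borel_sandwiched mu (A : set (borel X)) : (mu setT < +oo)%E ->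
  measurable A -> sandwiched mu A.
Proof.
move=> mufin.
suff : @measurable _ (borel X) `<=` [set A | measurable A /\ sandwiched mu A].
  by move=> /[apply] -[].
apply: smallest_sub; last first.
  by move=> U oU; split; [exact: borel_open|exact: open_sandwiched].
split.
- split => //; apply: open_sandwiched => //; exact: open0.
- move=> B [mB sB]; rewrite setTD; split; first exact: measurableC.
  exact: sandwichedC.
- move=> B mB; split; first by apply: bigcupT_measurable => n; have [] := mB n.
  by apply: bigcup_sandwiched => // n; have [] := mB n.
Qed.

Lemma compact_urysohn (F U : set X) : compact [set: X] -> closed F -> open U ->
  F `<=` U -> exists g : X -> R, [/\ continuous g, forall x, 0 <= g x <= 1,
    forall x, ~ U x -> g x = 0 & forall x, F x -> g x = 1].
Proof.
move=> cX cF oU FU.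
have /(@uniform_separatorP _ R)[g [cg g01 g0 g1]] : uniform_separator (~` U) F.
  apply: (@normal_separatorP R X).1 => //.
  - by apply: compact_normal => //; exact: metric_hausdorff.
  - exact: open_closedC.
  - by rewrite setIC; apply/disjoints_subset; rewrite setCK.
exists g; split => //.
- by move=> x; have := g01 _ (ex_intro2 _ _ x I erefl); rewrite /= in_itv.
- by move=> x Ux; apply: g0; exists x.
- by move=> x Fx; apply: g1; exists x.
Qed.

(** One function must serve both measures: a Urysohn function that is 1 on the union of the two
    inner closed sets and 0 off the intersection of the two outer open sets is squeezed between the
    inner and outer indicators of either measure. *)
Lemma borel_approx_continuous mu nu (A : set (borel X)) (e : R) :
  compact [set: X] -> (mu setT < +oo)%E -> (nu setT < +oo)%E -> measurable A ->
  0 < e -> exists g : X -> R, [/\ continuous g, forall x, 0 <= g x <= 1,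
    `|\int[mu]_x g x - fine (mu A)| <= e & `|\int[nu]_x g x - fine (nu A)| <= e].
Proof.
move=> cX mufin nufin mA e0.
have [F1 [U1 [cF1 oU1 F1A AU1 UF1]]] := borel_sandwiched mufin mA e0.
have [F2 [U2 [cF2 oU2 F2A AU2 UF2]]] := borel_sandwiched nufin mA e0.
have [g [cg g01 g0 g1]] : exists g : X -> R, [/\ continuous g,
    forall x, 0 <= g x <= 1, forall x, ~ (U1 `&` U2) x -> g x = 0
    & forall x, (F1 `|` F2) x -> g x = 1].
  apply: compact_urysohn => //; [exact: closedU|exact: openI|].
  by rewrite subUset !subsetI; split; split; apply: (@subset_trans _ A).
suff main (m : {measure set (borel X) -> \bar R}) (F U : set X) :
    (m setT < +oo)%E -> closed F -> open U ->
    F `<=` A -> A `<=` U -> F `<=` F1 `|` F2 -> U1 `&` U2 `<=` U ->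
    (m (U `\` F : set (borel X)) < e%:E)%E ->
    `|\int[m]_x g x - fine (m A)| <= e.
  exists g; split => //.
    by apply: (main mu F1 U1).
  by apply: (main nu F2 U2).
move=> mfin cF oU FA AU FF UU UF.
have mF := borel_closed cF; have mU := borel_open oU.
have ig : m.-integrable setT (EFin \o g) by exact: continuous_integrable.
have fm (B : set (borel X)) : measurable B -> m B \is a fin_num.
  move=> mB; rewrite ge0_fin_numE//; apply: le_lt_trans mfin.
  by apply: le_measure; rewrite ?inE.
have iI (B : set (borel X)) : measurable B -> m.-integrable setT (EFin \o \1_B).
  move=> mB; apply: measurable_bounded_integrable => //.
  exists 1; split => // r r1 x _; rewrite /= indicE.
  by apply: le_trans (ltW r1); case: (x \in B); rewrite ?normr1 ?normr0.
have gU : \int[m]_x g x <= fine (m U).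
  have -> : fine (m U) = \int[m]_x (\1_U x).
    by rewrite /Rintegral integral_indic ?setIT.
  apply: le_Rintegral => //; first exact: iI.
  move=> x _; rewrite indicE; case: (boolP (x \in U)) => [_|/negP xU].
    by have /andP[] := g01 x.
  suff -> : g x = 0 by [].
  by apply: g0 => -[? ?]; apply: xU; rewrite inE; apply: UU.
have gF : fine (m F) <= \int[m]_x g x.
  have -> : fine (m F) = \int[m]_x (\1_F x).
    by rewrite /Rintegral integral_indic ?setIT.
  apply: le_Rintegral => //; first exact: iI.
  move=> x _; rewrite indicE; case: (boolP (x \in F)) => [xF|_].
    suff -> : g x = 1 by [].
    by apply: g1; apply: FF; rewrite inE in xF.
  by have /andP[] := g01 x.
have mUF : fine (m U) <= fine (m F) + e.
  rewrite -lee_fin EFinD !fineK ?fm//.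
  rewrite (_ : U = F `|` (U `\` F)); last first.
    by rewrite setDUK//; exact: subset_trans AU.
  apply: (le_trans (measureU2 _ _ _)) => //; first exact: measurableD.
  by rewrite leeD2l// ltW.
have lmA : fine (m A) <= fine (m U).
  by apply: fine_le; rewrite ?fm//; apply: le_measure; rewrite ?inE.
have lmF : fine (m F) <= fine (m A).
  by apply: fine_le; rewrite ?fm//; apply: le_measure; rewrite ?inE.
rewrite ler_norml; apply/andP; split; lra.
Qed.

Lemma eq_measure_continuous mu nu : compact [set: X] ->
  (mu setT < +oo)%E -> (nu setT < +oo)%E ->
  (forall g : X -> R, continuous g -> \int[mu]_x g x = \int[nu]_x g x) ->
  forall A : set (borel X), measurable A -> mu A = nu A.
Proof.
move=> cX mufin nufin mununu A mA.
have fm (m : {measure set (borel X) -> \bar R}) :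
    (m setT < +oo)%E -> m A \is a fin_num.
  move=> mfin; rewrite ge0_fin_numE//; apply: le_lt_trans mfin.
  by apply: le_measure; rewrite ?inE.
rewrite -[LHS]fineK ?fm// -[RHS]fineK ?fm//; congr EFin.
apply/eqP; rewrite -subr_eq0 -normr_le0; apply/ler_addgt0Pl => e e0.
have e20 : 0 < e / 2 by rewrite divr_gt0.
have [g [cg _ gmu gnu]] := borel_approx_continuous cX mufin nufin mA e20.
rewrite addr0; rewrite (mununu g cg) in gmu.
move: gmu gnu; rewrite !ler_norml => /andP[? ?] /andP[? ?]; apply/andP; split; lra.
Qed.

End borel_regularity.

(** * Riesz representation on a compact metric space *)

Section riesz_representation.
Context {R : realType} {X : pmetricType R}.
Implicit Types (f g : X -> R) (A U V : set X).
Hypothesis cX : compact [set: X].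
(** [L] is total on all maps, so its properties are assumed for continuous arguments only; elsewhere
    its values are arbitrary. *)
Variable L : (X -> R) -> R.
Hypothesis L_ge0 : forall f, continuous f -> (forall x, 0 <= f x) -> 0 <= L f.
Hypothesis L_linear : forall (a : R) f g, continuous f -> continuous g ->
  L (fun x => a * f x + g x) = a * L f + L g.
Hypothesis L1 : L (fun=> 1) = 1.

Let cst_cont (a : R) : continuous (fun _ : X => a).
Proof. by move=> x; exact: cvg_cst. Qed.

Let aff_cont (a : R) f g : continuous f -> continuous g ->
  continuous (fun x => a * f x + g x).
Proof.
move=> cf cg x; apply: cvgD; last exact: cg.
by apply: cvgM; [exact: cvg_cst|exact: cf].
Qed.

Lemma L_cst (a : R) : L (fun=> a) = a.
Proof.
have L0 : L (fun=> 0) = 0.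
  have := L_linear (-1) (@cst_cont 1) (@cst_cont 1).
  by under eq_fun do rewrite mulr1 addNr; rewrite L1 mulr1 addNr.
have := L_linear a (@cst_cont 1) (@cst_cont 0); rewrite L1 L0.
by under eq_fun do rewrite addr0 mulr1; rewrite mulr1 addr0.
Qed.

Lemma L_le f g : continuous f -> continuous g -> (forall x, f x <= g x) ->
  L f <= L g.
Proof.
move=> cf cg fg; rewrite -subr_ge0; have := L_linear (-1) cf cg.
rewrite mulN1r addrC => <-; apply: L_ge0; first exact: aff_cont.
by move=> x; rewrite mulN1r addrC subr_ge0.
Qed.

Lemma L_add f g : continuous f -> continuous g ->
  L (fun x => f x + g x) = L f + L g.
Proof.
move=> cf cg; have := L_linear 1 cf cg.
by under eq_fun do rewrite mul1r; rewrite mul1r.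
Qed.

Lemma L_addc f (a : R) : continuous f -> L (fun x => f x + a) = L f + a.
Proof. by move=> cf; rewrite L_add// L_cst. Qed.

(** Domination by the indicator replaces the usual condition of a support contained in [U]; where a
    margin is needed, a small constant is cut off [f]. *)
Definition below U f := continuous f /\ forall x, 0 <= f x <= \1_U x.

Definition open_content U : R := sup [set L f | f in below U].

Local Notation lam := open_content.

Lemma below0 U : below U (fun=> 0).
Proof. by split; [exact: cst_cont|move=> x; rewrite lexx indicE ler0n]. Qed.

Lemma below_le1 U f x : below U f -> 0 <= f x <= 1.
Proof.
by move=> [_ /(_ x)/andP[-> /le_trans->]].
Qed.

Lemma below_out U f x : below U f -> ~ U x -> f x = 0.
Proof.
move=> [_ /(_ x)]; rewrite indicE => f01 Ux; move: f01.
by rewrite memNset// => /andP[? ?]; apply/eqP; rewrite eq_le; apply/andP.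
Qed.

Lemma belowP U f : continuous f -> (forall x, 0 <= f x <= 1) ->
  (forall x, ~ U x -> f x = 0) -> below U f.
Proof.
move=> cf f01 f0; split => // x; rewrite indicE.
case: (boolP (x \in U)) => [_|/negP xU]; first exact: f01.
by rewrite f0 ?lexx// => Ux; apply: xU; rewrite inE.
Qed.

Lemma has_sup_below U : has_sup [set L f | f in below U].
Proof.
split; first by exists (L (fun=> 0)), (fun=> 0) => //; exact: below0.
exists 1 => _ [f Uf <-]; rewrite -L1; apply: L_le => //; first by case: Uf.
by move=> x; have /andP[] := below_le1 x Uf.
Qed.

Lemma le_content U f : below U f -> L f <= lam U.
Proof.
by move=> Uf; apply: ub_le_sup; [have [] := has_sup_below U|exists f].
Qed.

Lemma content_le U (a : R) : (forall f, below U f -> L f <= a) -> lam U <= a.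
Proof.
move=> h; apply: ge_sup; first by have [] := has_sup_below U.
by move=> _ [f Uf <-]; exact: h.
Qed.

Lemma content_ge0 U : 0 <= lam U.
Proof. by rewrite -(L_cst 0); exact/le_content/below0. Qed.

Lemma content_le1 U : lam U <= 1.
Proof.
apply: content_le => f Uf; rewrite -L1; apply: L_le => //; first by case: Uf.
by move=> x; have /andP[] := below_le1 x Uf.
Qed.

Lemma contentT : lam setT = 1.
Proof.
apply/eqP; rewrite eq_le content_le1 -{1}L1; apply: le_content.
by apply: belowP => // x; [rewrite ler01 lexx|move=> /(_ I)].
Qed.

Lemma content0 : lam set0 = 0.
Proof.
apply/eqP; rewrite eq_le content_ge0 andbT; apply: content_le => f f0.
rewrite -(L_cst 0); apply: L_le => //; first by case: f0.
by move=> x; rewrite (below_out f0).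
Qed.

Lemma content_mono U V : U `<=` V -> lam U <= lam V.
Proof.
move=> UV; apply: content_le => f Uf; apply: le_content; apply: belowP.
- by case: Uf.
- by move=> x; exact: (below_le1 x Uf).
- by move=> x Vx; apply: (below_out Uf) => /UV/Vx.
Qed.

Lemma max_cont f g : continuous f -> continuous g ->
  continuous (fun x => Num.max (f x) (g x)).
Proof. by move=> cf cg x; apply: (@continuous_max R); [exact: cf|exact: cg]. Qed.

Lemma min_cont f g : continuous f -> continuous g ->
  continuous (fun x => Num.min (f x) (g x)).
Proof. by move=> cf cg x; apply: continuous_min; [exact: cf|exact: cg]. Qed.

(** Running maxima of Urysohn functions along a closed exhaustion of [U]. Monotonicity and the exact
    value 1 after finitely many steps are what Dini's argument uses. *)
Lemma indic_approx U : open U -> exists g : nat -> X -> R,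
  [/\ forall n, below U (g n), forall m n x, (m <= n)%N -> g m x <= g n x
    & forall x, U x -> exists n, g n x = 1].
Proof.
move=> oU; have [F [cF FU _ FP]] := open_exhaustion oU.
have /choice[u uP] := fun n => compact_urysohn cX (cF n) oU (FU n).
pose g := fix g n x := if n is m.+1 then Num.max (g m x) (u m.+1 x) else u 0%N x.
have gU n : below U (g n).
  elim: n => [|n [cg g1]].
    by have [? ? ? _] := uP 0%N; exact: belowP.
  have [cu u01 u0 _] := uP n.+1; have [_ u1] := belowP cu u01 u0.
  split; first exact: max_cont.
  move=> x; have /andP[gx0 gx1] := g1 x; have /andP[_ ux1] := u1 x.
  by rewrite /= ge_max le_max gx0 gx1 ux1.
have g_nd m n x : (m <= n)%N -> g m x <= g n x.
  move=> mn; rewrite -(subnK mn); elim: (n - m)%N => // k IH.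
  by rewrite addSn; apply: le_trans IH _; rewrite /= le_max lexx.
exists g; split => // x /FP[n Fn]; exists n.
apply/eqP; rewrite eq_le; have /andP[_ ->] := below_le1 x (gU n).
have [_ _ _ /(_ _ Fn) un] := uP n.
by rewrite -un; case: n {Fn un} => //= n; rewrite le_max lexx orbT.
Qed.

Lemma L_sum (F : nat -> X -> R) n : (forall i, continuous (F i)) ->
  continuous (fun x => \sum_(i < n) F i x) /\
  L (fun x => \sum_(i < n) F i x) = \sum_(i < n) L (F i).
Proof.
move=> cF; elim: n => [|n [cS LS]].
  by under eq_fun do rewrite big_ord0; rewrite big_ord0 L_cst; split.
under eq_fun do rewrite big_ord_recr /=.
rewrite big_ord_recr/= -LS -L_add//; split => //.
by move=> x; apply: cvgD; [exact: cS|exact: cF].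
Qed.

(* Dini's theorem: [f <= e + sum_(i < n) g i n] holds uniformly for large [n]. *)
Lemma content_bigcup (U : (set X)^nat) f (e : R) : (forall n, open (U n)) ->
  below (\bigcup_n U n) f -> 0 < e ->
  exists n, L f <= e + \sum_(i < n) lam (U i).
Proof.
move=> oU Uf e0; have /choice[g gP] := fun i => indic_approx (oU i).
have cg i n : continuous (g i n) by have [/(_ n)[]] := gP i.
have g_ge0 i n x : 0 <= g i n x by have [/(_ n)/(below_le1 x)/andP[]] := gP i.
have [n fn] : exists n, forall x, f x <= e + \sum_(i < n) g i n x.
  have : \forall n \near \oo,
      [set: X] `<=` (fun x => f x <= e + \sum_(i < n) g i n x).
    move/compact_near_coveringP : (cX); apply => x _.
    have cf : continuous f by case: Uf.
    have [[i _ Uix]|Ux] := pselect ((\bigcup_n U n) x).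
      have [_ g_nd /(_ _ Uix)[k gk]] := gP i.
      have near_gk : \forall y \near x, 1 - e < g i k y.
        by apply: (cvgr_gt _ (cg i k x)); rewrite gk ltrBlDr ltrDl.
      exists ([set y | 1 - e < g i k y], [set n | (maxn i.+1 k <= n)%N]).
        by split => //=; exists (maxn i.+1 k).
      move=> [y n] /= [gy]; rewrite geq_max => /andP[ilt kn].
      have /andP[_ f1] := below_le1 y Uf.
      have gn := g_nd _ _ y kn.
      have : g i n y <= \sum_(j < n) g j n y.
        by rewrite (bigD1 (Ordinal ilt))//= lerDl sumr_ge0.
      lra.
    have near_f : \forall y \near x, f y < e.
      by apply: (cvgr_lt _ (cf x)); rewrite (below_out Uf Ux).
    exists ([set y | f y < e], setT); first by split => //; exact: filterT.
    move=> [y n] /= [fy _]; apply: (le_trans (ltW fy)).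
    by rewrite lerDl sumr_ge0.
  by move=> [n _ /(_ n (leqnn _)) H]; exists n => x; exact: H.
exists n; have [cS LS] := L_sum n (fun i => cg i n).
apply: (@le_trans _ _ (L (fun x => (\sum_(i < n) g i n x) + e))).
  apply: L_le => //; first by case: Uf.
    by move=> x; apply: cvgD; [exact: cS|exact: cvg_cst].
  by move=> x; rewrite addrC.
rewrite L_addc// addrC lerD2l LS; apply: ler_sum => i _; apply: le_content.
by have [] := gP i.
Qed.

Definition riesz_outer A : \bar R :=
  (inf [set lam U | U in [set U | open U /\ A `<=` U]])%:E.

Local Notation mu := riesz_outer.

Let has_inf_content A : has_inf [set lam U | U in [set U | open U /\ A `<=` U]].
Proof.
split; first by exists (lam setT), setT => //; split => //; exact: openT.
by exists 0 => _ [U _ <-]; exact: content_ge0.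
Qed.

Lemma outer_le U A : open U -> A `<=` U -> (mu A <= (lam U)%:E)%E.
Proof.
move=> oU AU; rewrite lee_fin; apply: ge_inf; last by exists U.
by have [] := has_inf_content A.
Qed.

Lemma le_outer A (a : R) : (forall U, open U -> A `<=` U -> a <= lam U) ->
  (a%:E <= mu A)%E.
Proof.
move=> h; rewrite lee_fin; apply: lb_le_inf; first by have [] := has_inf_content A.
by move=> _ [U [oU AU] <-]; exact: h.
Qed.

Lemma outer_open U : open U -> mu U = (lam U)%:E.
Proof.
move=> oU; apply/eqP; rewrite eq_le outer_le//= le_outer// => V oV UV.
exact: content_mono.
Qed.

Lemma outer_adherent A (e : R) : 0 < e ->
  exists U, [/\ open U, A `<=` U & ((lam U)%:E <= mu A + e%:E)%E].
Proof.
move=> e0; have [_ [U [oU AU] <-] UA] := inf_adherent e0 (has_inf_content A).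
by exists U; split => //; rewrite -EFinD lee_fin ltW.
Qed.

Lemma riesz_outer0 : mu set0 = 0%E.
Proof. by rewrite outer_open ?content0//; exact: open0. Qed.

Lemma riesz_outer_ge0 A : (0 <= mu A)%E.
Proof. by apply: le_outer => U _ _; exact: content_ge0. Qed.

Lemma le_riesz_outer : {homo mu : A B / A `<=` B >-> (A <= B)%E}.
Proof.
move=> A B AB; apply: le_outer => U oU BU; rewrite -lee_fin.
by apply: outer_le => //; exact: subset_trans BU.
Qed.

Lemma riesz_outer_sigma_subadditive : sigma_subadditive mu.
Proof.
move=> A; apply/lee_addgt0Pr => e e0.
have e20 : 0 < e / 2 by rewrite divr_gt0.
have en0 (n : nat) : 0 < e / 2 / (2 ^ n.+1)%:R.
  by rewrite divr_gt0// ltr0n expn_gt0.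
have /choice[U UP] := fun n => outer_adherent (A n) (en0 n).
have oU n : open (U n) by have [] := UP n.
apply: (@le_trans _ _ (lam (\bigcup_n U n))%:E).
  apply: outer_le; first by apply: bigcup_open => n _.
  by move=> x [n _ Ax]; exists n => //; have [_ + _] := UP n; apply.
have fin_ge0 (n : nat) : (0 <= mu (A n) + (e / 2 / (2 ^ n.+1)%:R)%:E)%E.
  by rewrite adde_ge0 ?riesz_outer_ge0// lee_fin ltW.
have bound f : below (\bigcup_n U n) f ->
    ((L f)%:E <= \sum_(0 <= i <oo) mu (A i) + e%:E)%E.
  move=> Uf; have [n Lf] := content_bigcup oU Uf e20.
  apply: (@le_trans _ _ ((e / 2)%:E + (\sum_(i < n) lam (U i))%:E)%E).
    by rewrite -EFinD lee_fin.
  rewrite [e in leRHS]splitr EFinD addeA addeC; apply: leeD => //.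
  apply: le_trans (epsilon_trick _ (fun n => riesz_outer_ge0 (A n)) (ltW e20)).
  apply: le_trans (@nneseries_lim_ge _ _ xpredT 0%N n (fun n _ _ => fin_ge0 n)).
  rewrite big_mkord -sumEFin; apply: lee_sum => i _.
  by have [] := UP i.
(* [content_le] takes a real bound, so a divergent series is treated apart, where the claim is
   trivial. *)
have [fin|] := boolP ((\sum_(0 <= i <oo) mu (A i) + e%:E)%E \is a fin_num).
  rewrite -(fineK fin) lee_fin; apply: content_le => f Uf.
  by rewrite -lee_fin fineK//; exact: bound.
rewrite ge0_fin_numE; last first.
  rewrite adde_ge0 ?lee_fin ?(ltW e0)//; apply: nneseries_ge0 => n _ _.
  exact: riesz_outer_ge0.
by rewrite ltey negbK => /eqP ->; rewrite leey.
Qed.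

HB.instance Definition _ := isOuterMeasure.Build R X riesz_outer
  riesz_outer0 riesz_outer_ge0 le_riesz_outer riesz_outer_sigma_subadditive.

(** For an open [V] containing [A], take [f] below [V] and [U] jointly and cut [e] off it. The
    result lives on the closed set [K] where [e <= f], so adding any function below [V \ K] stays
    below [V]. Since [V \ K] still covers the part of [A] outside [U], suprema over both functions
    give the Caratheodory inequality as [e] tends to 0. *)
Lemma open_caratheodory U : open U -> mu.-caratheodory U.
Proof.
move=> oU; apply: le_caratheodory_measurable => A.
have muE B : mu B = (fine (mu B))%:E by [].
rewrite /= (muE (A `&` U)) (muE (A `&` ~` U)) -EFinD.
apply: le_outer => V oV AV; rewrite -lee_fin EFinD -!muE.
have oVU : open (V `&` U) by exact: openI.
apply: (@le_trans _ _ ((lam (V `&` U))%:E + mu (A `&` ~` U))%E).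
  apply: leeD => //; apply: outer_le => //.
  by move=> x [/AV]; split.
pose b := fine (mu (A `&` ~` U)).
rewrite -[mu (A `&` ~` U)]/(b%:E) -EFinD lee_fin -lerBrDr.
apply: content_le => f VUf; rewrite lerBrDr; apply/ler_addgt0Pr => e e0.
have cf : continuous f by case: VUf.
pose f' x := Num.max (f x - e) 0.
have cf' : continuous f'.
  apply: max_cont => // x; apply: cvgB; [exact: cf|exact: cvg_cst].
pose K := f @^-1` [set r | e <= r].
have cK : closed K by apply: closed_comp => //; exact: closed_ge.
have KVU : K `<=` V `&` U.
  move=> x Kx; apply: contrapT => /(below_out VUf) fx.
  by move: Kx; rewrite /K /= fx leNgt e0.
have oVK : open (V `\` K) by rewrite setDE; apply: openI => //; exact: closed_openC.
have bVK : b <= lam (V `\` K).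
  rewrite -lee_fin; apply: outer_le => // x [/AV Vx Ux]; split => // /KVU[].
  by [].
have Lf : L f <= L f' + e.
  rewrite -L_addc//; apply: L_le => //.
    by move=> x; apply: cvgD; [exact: cf'|exact: cvg_cst].
  by move=> x; rewrite /f' -lerBlDr le_max lexx.
suff : lam (V `\` K) <= lam V - L f' by lra.
apply: content_le => g VKg; rewrite lerBrDr addrC -L_add//; last by case: VKg.
have cg : continuous g by case: VKg.
apply: le_content; apply: belowP.
- by move=> x; apply: cvgD; [exact: cf'|exact: cg].
- move=> x; have /andP[g0 g1] := below_le1 x VKg.
  have /andP[f0 f1] := below_le1 x VUf.
  have [Kx|/negP] := boolP (e <= f x).
    rewrite (below_out VKg) ?addr0; last by case.
    by rewrite /f' le_max lexx orbT ge_max ler01 andbT/=; lra.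
  rewrite /f' => /negP; rewrite -ltNge => fxe.
  by rewrite (max_idPr _) ?add0r ?g0// subr_le0 ltW.
- move=> x Vx; rewrite (below_out VKg); last by case.
  rewrite /f' (below_out VUf) ?addr0 ?sub0r; last by case.
  by rewrite (max_idPr _)// oppr_le0 ltW.
Qed.

Lemma borel_caratheodory (A : set (borel X)) : measurable A -> mu.-caratheodory A.
Proof.
apply: (smallest_sub (sigma_algebra_measurable (caratheodory_type mu))) => U.
exact: open_caratheodory.
Qed.

Definition riesz_measure : set (borel X) -> \bar R := riesz_outer.

Let riesz_measure_sigma_additive : semi_sigma_additive riesz_measure.
Proof.
move=> A mA tA mUA.
apply: (@caratheodory_measure_sigma_additive R X riesz_outer) => //.
  by move=> n; exact: borel_caratheodory.
exact: borel_caratheodory.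
Qed.

HB.instance Definition _ := isMeasure.Build _ (borel X) R riesz_measure
  riesz_outer0 riesz_outer_ge0 riesz_measure_sigma_additive.

Let riesz_measureT : riesz_measure setT = 1%E.
Proof. by rewrite /riesz_measure outer_open ?contentT//; exact: openT. Qed.

HB.instance Definition _ := Measure_isProbability.Build _ (borel X) R
  riesz_measure riesz_measureT.

Let P : {measure set (borel X) -> \bar R} := riesz_measure.

Let P_fin : (P setT < +oo)%E.
Proof. by rewrite [P _]riesz_measureT ltry. Qed.

Let P_integrable f : continuous f -> P.-integrable setT (EFin \o f).
Proof. exact: continuous_integrable. Qed.

(** For nonnegative [f] this is the ceiling of [f x] truncated at [m]. It is a sum of indicators of
    open sets, whose integrals are contents and so dominate values of [L]. *)
Let level_count f m x : R := \sum_(i < m) ((i%:R < f x)%R : nat)%:R.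

(* The slice of [f] between heights [m] and [m + 1] is below the open set where
   [f > m]; summing the indicators of these sets overshoots [f] by at most 1. *)
Lemma L_slices f m : continuous f -> (forall x, 0 <= f x) ->
  [/\ P.-integrable setT (EFin \o level_count f m : borel X -> \bar R),
      forall x, level_count f m x <= m%:R,
      forall x, level_count f m x <= f x + 1
    & L (fun x => Num.min m%:R (f x)) <= \int[P]_x level_count f m x].
Proof.
move=> cf f0; elim: m => [|m [iNm Nm_le Nm_f LNm]].
  have -> : level_count f 0 = cst 0.
    by apply/funext => x; rewrite /level_count big_ord0.
  split => //.
  - by apply: P_integrable; exact: cst_cont.
  - by move=> x; rewrite /= addr_ge0.
  - rewrite Rintegral_cst// mul0r (_ : (fun x => _) = fun=> 0) ?L_cst//.
    by apply/funext => x; apply/min_idPl.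
pose U := f @^-1` [set r | m%:R < r].
have oU : open U by move/continuousP : cf; apply; exact: open_gt.
have iU : P.-integrable setT (EFin \o \1_U : borel X -> \bar R).
  apply: measurable_bounded_integrable => //.
    by apply: measurable_indic; exact: borel_open.
  exists 1; split => // r r1 x _; rewrite /= indicE.
  by apply: le_trans (ltW r1); case: (x \in U); rewrite ?normr1 ?normr0.
have -> : level_count f m.+1 = (fun x => level_count f m x + \1_U x).
  apply/funext => x; rewrite /level_count big_ord_recr/= indicE.
  by congr (_ + _%:R); congr nat_of_bool; apply/idP/idP; rewrite inE.
split.
- rewrite (_ : EFin \o _ = (EFin \o level_count f m) \+ (EFin \o \1_U))//.
  exact: integrableD.
- move=> x; rewrite -[m.+1]addn1 natrD lerD//.
  by rewrite indicE; case: (_ \in _).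
- move=> x; rewrite indicE; case: (boolP (x \in U)) => xU; last first.
    by rewrite addr0.
  rewrite lerD2r; apply: le_trans (Nm_le x) _; apply: ltW.
  by rewrite inE in xU.
- rewrite RintegralD//.
  have -> : \int[P]_x \1_U x = lam U.
    rewrite /Rintegral integral_indic// ?setIT; last exact: borel_open.
    by have -> : P U = (lam U)%:E by exact: outer_open.
  pose c x := Num.min 1 (Num.max 0 (f x - m%:R)).
  have cc : continuous c.
    apply: min_cont; first exact: cst_cont.
    apply: max_cont; first exact: cst_cont.
    by move=> x; apply: cvgB; [exact: cf|exact: cvg_cst].
  have cm : continuous (fun x => Num.min m%:R (f x)).
    by apply: min_cont => //; exact: cst_cont.
  have -> : (fun x => Num.min m.+1%:R (f x)) =
            (fun x => Num.min m%:R (f x) + c x).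
    apply/funext => x; rewrite /c -[m.+1]addn1 natrD.
    have := f0 x; move: (f x) => y y0.
    have m0 : 0 <= m%:R :> R by [].
    have [h1|h1] := leP y m%:R.
      rewrite (min_idPr _); last by lra.
      rewrite (max_idPl _); last by lra.
      by rewrite (min_idPr _) ?addr0.
    rewrite (max_idPr _); last by lra.
    have [h2|h2] := leP y (m%:R + 1).
      by rewrite (min_idPr _); lra.
    by rewrite (min_idPl _); lra.
  rewrite L_add//; apply: lerD => //; apply: le_content; apply: belowP => //.
    by move=> x; rewrite /c ge_min lexx le_min ler01 le_max lexx.
  move=> x Ux; rewrite /c (max_idPl _) ?(min_idPr _)//.
  by rewrite subr_le0 leNgt; exact/negP.
Qed.

(** The overshoot by 1 in [L_slices] is made harmless by slicing [(n + 1) * f] instead of [f]: after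
    division it costs [1 / (n + 1)]. As [f <= 1], truncation at height [n + 1] changes nothing. *)
Lemma L_le_riesz01 f : continuous f -> (forall x, 0 <= f x <= 1) ->
  L f <= \int[P]_x f x.
Proof.
move=> cf f01; apply/ler_addgt0Pr => e e0.
have [n ne] := ltr_add_invr (y := 0) (x := e) e0; rewrite add0r in ne.
have L0 (a : R) g : continuous g -> L (fun x => a * g x) = a * L g.
  move=> cg; have := L_linear a cg (@cst_cont 0); rewrite L_cst addr0.
  by under eq_fun do rewrite addr0.
pose a : R := n.+1%:R; have a0 : 0 < a by [].
have ca : continuous (fun x => a * f x).
  by move=> x; apply: cvgM; [exact: cvg_cst|exact: cf].
have f_ge0 x : 0 <= a * f x by rewrite mulr_ge0//; have /andP[] := f01 x.
have [iN _ Nf LN] := L_slices n.+1 ca f_ge0.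
rewrite -(ler_pM2l a0) -L0// mulrDr.
have -> : (fun x => a * f x) = (fun x => Num.min a (a * f x)).
  apply/funext => x; rewrite (min_idPr _)//.
  by rewrite -[leRHS]mulr1 ler_pM2l//; have /andP[] := f01 x.
apply: (le_trans LN).
apply: (@le_trans _ _ (\int[P]_x (a * f x + 1))).
  apply: le_Rintegral => //; apply: P_integrable.
  by move=> x; apply: cvgD; [exact: ca|exact: cvg_cst].
rewrite RintegralD//; [|exact: P_integrable|exact: P_integrable].
rewrite RintegralZl//; last exact: P_integrable.
rewrite Rintegral_cst// mul1r [P _]riesz_measureT lerD2l.
by rewrite mulrC -ler_pdivrMr// mul1r ltW.
Qed.

Lemma riesz_integral f : continuous f -> \int[P]_x f x = L f.
Proof.
(* One inequality suffices, since it also applies to the opposite function. *)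
suff le g : continuous g -> L g <= \int[P]_x g x.
  move=> cf; apply/eqP; rewrite eq_le le// andbT.
  have LN := L_linear (-1) cf (@cst_cont 0).
  have cN : continuous (fun x => -1 * f x + 0).
    by apply: aff_cont.
  have := le _ cN; rewrite LN L_cst.
  under eq_Rintegral do rewrite addr0.
  by rewrite RintegralZl//; [lra|exact: P_integrable].
move=> cg; have [c c0 gc] := continuous_compact_bounded cX cg.
(* With [|g| <= c], the function [(g + c) / s] takes values in [[0, 1]]; the added 1 keeps [s]
   positive when [c = 0]. *)
pose s := 2 * c + 1; have s0 : 0 < s by rewrite /s; lra.
have ch : continuous (fun x => s^-1 * g x + c / s).
  by apply: aff_cont.
have := L_le_riesz01 ch; rewrite L_linear// L_cst.
rewrite RintegralD//; [|apply: P_integrable|exact: P_integrable]; last first.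
  by move=> x; apply: cvgM; [exact: cvg_cst|exact: cg].
rewrite Rintegral_cst// [P _]riesz_measureT mulr1 lerD2r.
rewrite RintegralZl//; last exact: P_integrable.
rewrite ler_pM2l ?invr_gt0//; apply.
move=> x; have := gc x; rewrite ler_norml => /andP[g1 g2].
rewrite [_^-1 * _]mulrC -mulrDl; apply/andP; split.
  by rewrite divr_ge0 ?(ltW s0)//; lra.
by rewrite ler_pdivrMr// mul1r /s; lra.
Qed.

Theorem riesz_representation : exists Q : probability (borel X) R,
  forall f, continuous f -> \int[Q]_x f x = L f.
Proof. by exists riesz_measure => f; exact: riesz_integral. Qed.

End riesz_representation.

Lemma ultra_fmap (S Y : Type) (f : S -> Y) (F : set_system S) :
  UltraFilter F -> UltraFilter (f @ F).
Proof.
move=> FU; have FF : ProperFilter F by exact: ultra_proper.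
split=> [|H HF fFH]; first exact: fmap_proper_filter.
apply/seteqP; split => // A HA.
have [//|FnA] := in_ultra_setVsetC (f @^-1` A) FU.
have : H set0 by rewrite -(setICr A); apply: filterI => //; exact: fFH.
by move/filter_ex => -[].
Qed.

(** * Compactness of the set of invariant measures *)

Lemma cvg_initial (S : choiceType) (Y : topologicalType) (f : S -> Y)
    (F : set_system S) (s : S) : Filter F ->
  f @ F --> f s -> F --> (s : initial_topology f).
Proof.
move=> FF fF A [_ [[B oB <-] Bs BA]]; apply: filterS BA _.
by apply: fF; exact: open_nbhs_nbhs.
Qed.

Lemma cvg_ptws (S : Type) (Y : topologicalType) (F : set_system (S -> Y))
    (f : S -> Y) : Filter F ->
  (forall i, (g i @[g --> F]) --> f i) -> F --> (f : {ptws S -> Y}).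
Proof.
move=> FF Ff; apply/cvg_sup => i; apply: cvg_initial; exact: Ff.
Qed.

Section weak_star_compactness.
Context {R : realType} {X : pmetricType R} {G : topSemigroupType}.
Context {T : G -> X -> X}.
Local Notation M := (invariant_measure T).
Implicit Types (f : X -> R) (g : G) (mu nu : M).

Definition mean mu f : R := \int[prob_of mu]_x f x.
Local Notation E := mean.

Lemma mean_continuous f : continuous f -> continuous (fun mu => E mu f).
Proof.
move=> cf mu.
pose phi : potential X := mkcts cf.
have c1 : continuous (set_val : M -> borel_probability X) by exact: initial_continuous.
have c2 : continuous (@integral_against R X) by exact: initial_continuous.
have c3 := @proj_continuous (potential X) (fun=> R) phi.
apply: (@continuous_comp M {ptws potential X -> R} R
  (@integral_against R X \o set_val) (fun u => u phi)); last exact: c3.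
by apply: continuous_comp; [exact: c1|exact: c2].
Qed.

(** The topology is initial three times over: subspace, then integration map, then coordinates of
    the product. Convergence is therefore tested on means of continuous functions. *)
Lemma cvg_invariant_measure (F : set_system M) mu : Filter F ->
  (forall f, continuous f -> (E nu f @[nu --> F]) --> E mu f) -> F --> mu.
Proof.
move=> FF Fmu; apply: (@cvg_initial M (borel_probability X) set_val).
apply: (@cvg_initial (borel_probability X) {ptws potential X -> R}
  (@integral_against R X)).
apply: (@cvg_ptws (potential X) R) => phi; apply: Fmu.
exact: cts_fun.
Qed.

Hypothesis XT : dynamical_system T.

Let cX : compact [set: X]. Proof. by case: XT. Qed.

Let cT g : continuous (T g). Proof. by case: XT => _ /(_ g). Qed.

Lemma borel_measurable_action g :
  measurable_fun [set: borel X] (T g : borel X -> borel X).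
Proof.
apply: (@measurability _ _ (borel X) (borel X) setT (T g) (@open X)) => //.
move=> _ [U oU <-]; rewrite setTI; apply: borel_open.
by move/continuousP : (@cT g); apply.
Qed.

Let action_pushforward (P : probability (borel X) R) g :
    {measure set (borel X) -> \bar R} :=
  measure_function_pushforward__canonical__measure_function_Measure P
    (borel_measurable_action g).

Lemma Rintegral_action (P : probability (borel X) R) g f : continuous f ->
  \int[action_pushforward P g]_x f x = \int[P]_x f (T g x).
Proof.
have Pfin : (P setT < +oo)%E by rewrite probability_setT ltry.
move=> cf; have mT := borel_measurable_action g.
have mf : measurable_fun [set: borel X] (EFin \o f : borel X -> \bar R).
  by apply/measurable_EFinP; exact: continuous_borel_measurable.
have ifT : P.-integrable (T g @^-1` [set: borel X]) ((EFin \o f) \o T g).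
  rewrite preimage_setT; apply: (@continuous_integrable _ _ _ (f \o T g) cX Pfin).
  by move=> x; apply: continuous_comp; [exact: cT|exact: cf].
by rewrite /Rintegral (integral_pushforward mT mf ifT).
Qed.

(** Invariance is restated through integrals of continuous functions because this form passes to
    weak-* limits: [f \o T g] is again continuous. *)
Lemma invariant_underP (P : borel_probability X) :
  invariant_under T P <->
  forall g f, continuous f -> \int[P]_x f (T g x) = \int[P]_x f x.
Proof.
have Pfin : (P setT < +oo)%E by rewrite probability_setT ltry.
split=> [Pinv g f cf|Pinv g A mA].
  rewrite -Rintegral_action// /Rintegral; congr fine.
  apply: eq_measure_integral => A mA _; exact: Pinv.
apply: (@eq_measure_continuous _ _ (action_pushforward P g) P) => //.
by move=> f cf; rewrite Rintegral_action//; exact: Pinv.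
Qed.

Let prob_fin mu : (prob_of mu setT < +oo)%E.
Proof. by rewrite probability_setT ltry. Qed.

Lemma mean_integrable mu f : continuous f ->
  (prob_of mu).-integrable setT (EFin \o f).
Proof. exact: (continuous_integrable cX (prob_fin mu)). Qed.

Lemma mean_linear mu (a : R) f1 f2 : continuous f1 -> continuous f2 ->
  E mu (fun x => a * f1 x + f2 x) = a * E mu f1 + E mu f2.
Proof.
move=> c1 c2; rewrite /E RintegralD//; last exact: mean_integrable.
  by rewrite RintegralZl//; exact: mean_integrable.
apply: (@mean_integrable mu (fun x => a * f1 x)).
by move=> x; apply: cvgM; [exact: cvg_cst|exact: c1].
Qed.

Lemma mean_le mu f1 f2 : continuous f1 -> continuous f2 ->
  (forall x, f1 x <= f2 x) -> E mu f1 <= E mu f2.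
Proof. by move=> c1 c2 f12; apply: le_Rintegral => //; exact: mean_integrable. Qed.

Lemma mean_cst mu (a : R) : E mu (fun=> a) = a.
Proof. by rewrite /E Rintegral_cst//= probability_setT mulr1. Qed.

Lemma mean_bound mu f (c : R) : continuous f ->
  (forall x, `|f x| <= c) -> `|E mu f| <= c.
Proof.
move=> cf fc; rewrite ler_norml -[- c](mean_cst mu).
rewrite -[X in _ && (_ <= X)](mean_cst mu c).
by apply/andP; split; apply: mean_le => //;
  [exact: cst_continuous| |exact: cst_continuous|] => x; have := fc x;
  rewrite ler_norml => /andP[].
Qed.

Lemma invariant_of_prob (P : borel_probability X) : invariant_under T P ->
  exists mu : M, prob_of mu = P.
Proof. by move=> iP; exists (SigSub (mem_set iP)). Qed.

(** Along an ultrafilter the mean of each continuous function stays in a compact interval, hence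
    converges. The limits form a positive normalized linear functional, which a probability measure
    represents; invariance survives by [invariant_underP]. *)
Theorem compact_invariant_measures : compact [set: M].
Proof.
rewrite compact_ultra => F FU _.
have FF : ProperFilter F by exact: ultra_proper.
have cvgE f : continuous f -> exists l, (E nu f @[nu --> F]) --> (l : R).
  move=> cf; have [c c0 fc] := continuous_compact_bounded cX cf.
  have := @segment_compact R (- c) c; rewrite compact_ultra.
  move=> /(_ (E nu f @[nu --> F]) (ultra_fmap _ FU))[].
    rewrite /fmap /=; apply: filterE => nu /=.
    by rewrite in_itv/= -ler_norml; exact: mean_bound.
  by move=> l [_ Fl]; exists l.
have /choice[L LP] : forall f, exists l : R,
    continuous f -> (E nu f @[nu --> F]) --> l.
  move=> f; have [cf|cf] := pselect (continuous f); last by exists 0.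
  by have [l lP] := cvgE f cf; exists l.
have [P PL] : exists P : probability (borel X) R,
    forall f, continuous f -> \int[P]_x f x = L f.
  apply: riesz_representation => //.
  - move=> f cf f0; rewrite -(cvg_lim (@Rhausdorff R) (LP f cf)).
    apply: limr_ge; first by apply/cvg_ex; exists (L f); exact: LP.
    apply: nearW => nu; rewrite -(mean_cst nu 0); apply: mean_le => //.
    exact: cst_continuous.
  - move=> a f1 f2 c1 c2; apply: (@cvg_unique _ (@Rhausdorff R)
        (E nu (fun x => a * f1 x + f2 x) @[nu --> F])).
      apply: LP => x; apply: cvgD; last exact: c2.
      by apply: cvgM; [exact: cvg_cst|exact: c1].
    have -> : (fun nu => E nu (fun x => a * f1 x + f2 x)) =
        (fun nu => a * E nu f1 + E nu f2).
      by apply/funext => nu; exact: mean_linear.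
    by apply: cvgD; [apply: cvgM; [exact: cvg_cst|exact: LP]|exact: LP].
  - apply: (@cvg_unique _ (@Rhausdorff R) (E nu (fun=> 1) @[nu --> F])).
      by apply: LP; exact: cst_continuous.
    have -> : (fun nu => E nu (fun=> 1)) = (fun=> 1).
      by apply/funext => nu; exact: mean_cst.
    exact: cvg_cst.
have [|mu muP] := invariant_of_prob (P := P).
  apply/invariant_underP => g f cf; rewrite !PL//; last first.
    by move=> x; apply: continuous_comp; [exact: cT|exact: cf].
  apply: (@cvg_unique _ (@Rhausdorff R) (E nu (f \o T g) @[nu --> F])).
    by apply: LP => x; apply: continuous_comp; [exact: cT|exact: cf].
  have -> : (fun nu => E nu (f \o T g)) = (fun nu => E nu f); last exact: LP.
  apply/funext => nu; move: g f cf; apply/invariant_underP.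
  by apply: set_mem; exact: valP.
exists mu; split => //; apply: cvg_invariant_measure => f cf.
by rewrite /E muP PL//; exact: LP.
Qed.

End weak_star_compactness.

Lemma compact_directed_bigcap (K : topologicalType) (I : Type) (D : set I)
    (P : I -> set K) : compact [set: K] -> D !=set0 ->
  (forall i j, D i -> D j -> exists2 k, D k & P k `<=` P i `&` P j) ->
  (forall i, D i -> closed (P i)) -> (forall i, D i -> P i !=set0) ->
  \bigcap_(i in D) P i !=set0.
Proof.
move=> cK D0 dirP clP P0.
have PF : ProperFilter (filter_from D P).
  by apply: filter_from_proper => //; exact: filter_from_filter.
have [|x [_ xP]] := cK _ PF; first exact: filterT.
by exists x => i Di; apply: clP => // B xB; apply: xP => //; exists i.
Qed.

(** * Extreme invariant measures *)

Section mixtures.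
Context {R : realType} {X : pmetricType R} {G : topSemigroupType}.
Context {T : G -> X -> X}.
Local Notation M := (invariant_measure T).
Implicit Types (f : X -> R) (g : G) (mu nu rho : M).
Local Notation E := mean.
Hypothesis XT : dynamical_system T.

Let cX : compact [set: X]. Proof. by case: XT. Qed.

Let prob_fin mu : (prob_of mu setT < +oo)%E.
Proof. by rewrite probability_setT ltry. Qed.

Lemma prob_of_invariant mu : invariant_under T (prob_of mu : borel_probability X).
Proof. by apply: set_mem; exact: valP. Qed.

Lemma normalized_invariant (m : {measure set (borel X) -> \bar R}) (c : R) mu0 :
  0 < c -> m setT = c%:E ->
  (forall g (A : set (borel X)), measurable A -> m (T g @^-1` A) = m A) ->
  exists mu, forall A, prob_of mu A = (m A * c^-1%:E)%E.
Proof.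
(* [mnormalize] takes a fallback probability for total mass zero or infinite; [mu0] supplies it, and
   [0 < c] excludes that case. *)
move=> c0 mT minv; pose P := mnormalize m (prob_of mu0).
have PE A : P A = (m A * c^-1%:E)%E.
  by rewrite /P /mnormalize mT eqe (gt_eqF c0).
have [|mu muP] := @invariant_of_prob R X G T (P : borel_probability X).
  have Pinv g (A : set (borel X)) : measurable A -> P (T g @^-1` A) = P A.
    by move=> mA; rewrite !PE minv.
  by move=> g A mA; exact: Pinv.
by exists mu => A; rewrite muP; exact: PE.
Qed.

Definition mixture (t : R) mu nu rho := forall A : set (borel X), measurable A ->
  prob_of rho A = (t%:E * prob_of mu A + (1 - t)%:E * prob_of nu A)%E.

Lemma mixture_ex (t : R) mu nu : 0 <= t <= 1 -> exists rho, mixture t mu nu rho.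
Proof.
move=> /andP[t0 t1].
have s0 : 0 <= 1 - t by rewrite subr_ge0.
pose m := measure_add (mscale (NngNum t0) (prob_of mu))
                      (mscale (NngNum s0) (prob_of nu)).
have mE A : m A = (t%:E * prob_of mu A + (1 - t)%:E * prob_of nu A)%E.
  by rewrite /m measure_addE.
have mT : m setT = 1%:E.
  by rewrite mE !probability_setT !mule1 -EFinD addrC subrK.
have minv g (A : set (borel X)) : measurable A -> m (T g @^-1` A) = m A.
  by move=> mA; rewrite !mE !prob_of_invariant.
have [rho rhoP] := @normalized_invariant m 1 mu ltr01 mT minv.
by exists rho => A _; rewrite rhoP invr1 mule1; exact: mE.
Qed.

Lemma mixture_mean (t : R) mu nu rho f : 0 <= t <= 1 -> mixture t mu nu rho ->
  continuous f -> E rho f = t * E mu f + (1 - t) * E nu f.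
Proof.
move=> /andP[t0 t1] mix cf.
have s0 : 0 <= 1 - t by rewrite subr_ge0.
pose m := measure_add (mscale (NngNum t0) (prob_of mu))
                      (mscale (NngNum s0) (prob_of nu)).
have mf : measurable_fun [set: borel X] (EFin \o f : borel X -> \bar R).
  by apply/measurable_EFinP; exact: continuous_borel_measurable.
(* Adding the bound [c] shifts both sides by [c] and makes [f] nonnegative, so that integrals split
   over the sum of the two scaled measures without integrability conditions. *)
wlog f0 : f cf mf / forall x, 0 <= f x => [ge0_case|].
  have [c c0 fc] := continuous_compact_bounded cX cf.
  have cc : continuous (fun _ : X => c) by exact: cst_continuous.
  have cfc : continuous (fun x => 1 * f x + c).
    by move=> x; apply: cvgD; [apply: cvgM; [exact: cvg_cst|exact: cf]|exact: cvg_cst].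
  have := ge0_case _ cfc; rewrite !(mean_linear XT)// !mean_cst !mul1r.
  have <- : t * E mu f + (1 - t) * E nu f + c =
            t * (E mu f + c) + (1 - t) * (E nu f + c) by ring.
  move=> ge0; apply: (addIr c); apply: ge0.
    by apply/measurable_EFinP; exact: continuous_borel_measurable.
  by move=> x; have := fc x; rewrite ler_norml mul1r => /andP[fc' _]; lra.
have -> : E rho f = fine (\int[m]_x (f x)%:E).
  rewrite /mean /Rintegral; congr fine; apply: eq_measure_integral => A mA _.
  by rewrite [LHS]mix// /m [RHS]measure_addE.
have f0' (x : borel X) : [set: borel X] x -> (0 <= (f x)%:E)%E by rewrite lee_fin.
rewrite /m ge0_integral_measure_add// !ge0_integral_mscale//.
have imu := integrable_fin_num measurableT (mean_integrable XT mu cf).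
have inu := integrable_fin_num measurableT (mean_integrable XT nu cf).
by rewrite fineD ?fin_numM// !fineM.
Qed.

(** Only the first component is compared with [mu]; the second follows on exchanging [t] and
    [1 - t]. *)
Definition extreme_measure mu := forall (t : R) nu rho, 0 < t < 1 ->
  mixture t nu rho mu -> forall A : set (borel X), measurable A ->
  prob_of nu A = prob_of mu A.

Definition face (F : set M) := forall (t : R) mu nu rho, 0 < t < 1 ->
  mixture t mu nu rho -> F rho -> F mu /\ F nu.

Definition maximizers f (F : set M) :=
  F `&` [set mu | forall nu, F nu -> E nu f <= E mu f].

Lemma maximizersE f (F : set M) mu : continuous f -> maximizers f F mu ->
  maximizers f F = F `&` [set nu | E mu f <= E nu f].
Proof.
move=> cf [Fmu mumax]; apply/seteqP; split=> nu [Fnu nuP]; split => //.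
  exact: nuP.
by move=> rho Frho; apply: le_trans nuP; exact: mumax.
Qed.

Lemma maximizers_nonempty f (F : set M) : continuous f -> closed F -> F !=set0 ->
  maximizers f F !=set0.
Proof.
move=> cf cF F0.
have kF : compact F.
  by apply: (subclosed_compact cF (compact_invariant_measures XT)).
have [|mu] := compact_EVT_max F0 kF (f := fun mu => E mu f).
  by apply: continuous_subspaceT; exact: mean_continuous.
rewrite inE => Fmu mumax; exists mu; split => // nu Fnu; apply: mumax.
by rewrite inE.
Qed.

Lemma maximizers_closed f (F : set M) : continuous f -> closed F -> F !=set0 ->
  closed (maximizers f F).
Proof.
move=> cf cF F0; have [mu muF] := maximizers_nonempty cf cF F0.
rewrite (maximizersE cf muF); apply: closedI => //.
apply: (@closed_comp _ _ (fun nu => E nu f) [set r | E mu f <= r]) => [nu _|].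
  exact: mean_continuous.
exact: closed_ge.
Qed.

Lemma maximizers_face f (F : set M) : continuous f -> face F ->
  face (maximizers f F).
Proof.
move=> cf faceF t mu nu rho t01 mix [Frho rhomax].
have [Fmu Fnu] := faceF _ _ _ _ t01 mix Frho.
have t01' : 0 <= t <= 1 by case/andP: t01 => ? ?; rewrite !ltW.
have rhoE := mixture_mean t01' mix cf.
have := rhomax _ Fmu; have := rhomax _ Fnu; rewrite rhoE.
move: t01 => /andP[t0 t1] h1 h2.
have eq12 : E mu f = E nu f.
  have {}h1 : t * E nu f <= t * E mu f by lra.
  have {}h2 : (1 - t) * E mu f <= (1 - t) * E nu f by lra.
  rewrite ler_pM2l// in h1; rewrite ler_pM2l ?subr_gt0// in h2.
  by apply/eqP; rewrite eq_le h1 h2.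
have {}rhoE : E rho f = E nu f by rewrite rhoE eq12; ring.
split; split => // k /rhomax; rewrite rhoE //.
by rewrite eq12.
Qed.

(* A minimal closed face inside the maximizers of [f] carries no nonconstant
   mean of a continuous function, hence reduces to one measure, up to its values
   on non-Borel sets. *)
Theorem extreme_maximizer f : continuous f -> [set: M] !=set0 ->
  exists2 mu, extreme_measure mu & forall nu, E nu f <= E mu f.
Proof.
move=> cf M0.
have faceT : face [set: M] by [].
pose F0 := maximizers f [set: M].
have F0ne : F0 !=set0 := maximizers_nonempty cf (@closedT _) M0.
have cF0 : closed F0 := maximizers_closed cf (@closedT _) M0.
have faceF0 : face F0 by exact: maximizers_face.
(* Zorn's lemma is used for unions, so faces are coded by complements: a maximal [U] corresponds to
   a minimal closed nonempty face in [F0]. *)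
pose P (U : set M) := let F := ~` U `&` F0 in [/\ closed F, F !=set0 & face F].
have [|U [[cF Fne faceF] Umax]] := @Zorn_bigcup M P.
  move=> C CP totC.
  have -> : P (\bigcup_(V in C) V) = P (~` \bigcap_(V in C) ~` V).
    by rewrite setC_bigcap; congr P; apply: eq_bigcupr => V _; rewrite setCK.
  (* The empty chain corresponds to the face [F0] itself; for a nonempty chain, compactness keeps
     the intersection of the faces nonempty. *)
  have [C0|C0] := pselect (C !=set0); last first.
    have -> : C = set0 by apply/seteqP; split => // V CV; apply: C0; exists V.
    by rewrite bigcap_set0 /P setCK setTI.
  have capE : ~` ~` (\bigcap_(V in C) ~` V) `&` F0 =
      \bigcap_(V in C) (~` V `&` F0).
    rewrite setCK; apply/seteqP; split=> [x [xC Fx] V CV|x xC].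
      by split => //; exact: xC.
    split=> [V CV|]; first by have [] := xC _ CV.
    by have [V CV] := C0; have [] := xC _ CV.
  rewrite /P capE; split.
  - by apply: closed_bigI => V /CP[].
  - apply: compact_directed_bigcap => //.
    + exact: compact_invariant_measures.
    + move=> V W CV CW; have [VW|WV] := totC _ _ CV CW.
        by exists W => // x [nWx F0x]; split; split => // /VW.
      by exists V => // x [nVx F0x]; split; split => // /WV.
    + by move=> V /CP[].
    + by move=> V /CP[].
  - move=> t mu nu rho t01 mix rhoC.
    by split=> V CV; have [_ _ fV] := CP _ CV;
      have [] := fV _ _ _ _ t01 mix (rhoC _ CV).
pose F := ~` U `&` F0.
have [mu Fmu] := Fne.
have const u : continuous u -> forall nu, F nu -> E nu u = E mu u.
  move=> cu.
  suff FE : maximizers u F = F.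
    move=> nu Fnu; apply/eqP; rewrite eq_le.
    move: (Fmu) (Fnu); rewrite -/F -FE => -[_ h1] [_ h2].
    by rewrite h1// h2.
  apply: contrapT => FneE.
  apply: (Umax (U `|` ~` maximizers u F)).
    split=> [x|BU]; first by left.
    apply: FneE; apply/seteqP; split=> x [] //.
    move=> nUx F0x; apply: contrapT => xu; apply: nUx; apply: BU; right.
    exact: xu.
  rewrite /P; have -> : ~` (U `|` ~` maximizers u F) `&` F0 = maximizers u F.
    rewrite setCU setCK; apply/seteqP; split=> [x [[]]//|x xu].
    by split; [split => //; have [[]] := xu|have [[]] := xu].
  split; [exact: maximizers_closed|exact: maximizers_nonempty|].
  exact: maximizers_face.
have muF0 : F0 mu by case: Fmu.
exists mu; last by move=> nu; have [_] := muF0; apply.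
move=> t nu rho t01 mix A mA; have [Fnu _] := faceF _ _ _ _ t01 mix Fmu.
apply: (eq_measure_continuous cX (prob_fin nu) (prob_fin mu)) => // u cu.
exact: const.
Qed.

End mixtures.

(* [m] is the infimum of [P] and [Q], read off a Hahn decomposition of [Q - P]. *)
Lemma measure_meet d (S : measurableType d) (R : realType) (P Q : probability S R) :
  exists (m p q : {measure set S -> \bar R}) (A : set S), [/\ measurable A,
    forall B, measurable B -> m B = (P (B `&` A) + Q (B `&` ~` A))%E,
    forall B, measurable B -> P B = (m B + p B)%E
    & forall B, measurable B -> Q B = (m B + q B)%E].
Proof.
pose D : {charge set S -> \bar R} := cadd (charge_of_finite_measure Q)
  (cscale (-1) (charge_of_finite_measure P)).
have DE B : D B = (Q B - P B)%E by rewrite /D /= /cadd /= /cscale mulN1e.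
have [A [N hAN]] := Hahn_decomposition D.
have [[mA _] [mN _] AN AN0] := hAN.
have NE : N = ~` A.
  apply/seteqP; split=> x.
    by move=> Nx Ax; have : (A `&` N) x by []; rewrite AN0.
  by move=> nAx; have [] : (A `|` N) x by rewrite AN.
pose m : {measure set S -> \bar R} := measure_add (mrestr P mA) (mrestr Q mN).
have mE B : m B = (P (B `&` A) + Q (B `&` N))%E by rewrite [LHS]measure_addE.
have split_AN (K : probability S R) B : measurable B ->
    K B = (K (B `&` A) + K (B `&` N))%E.
  move=> mB; rewrite -measureU; [|exact: measurableI|exact: measurableI|].
    by rewrite -setIUr AN setIT.
  by rewrite setIACA AN0 setI0.
have fin (K : probability S R) B : measurable B -> K B \is a fin_num.
  by move=> mB; exact: fin_num_measure.
have fin_sub (a b c : \bar R) : a \is a fin_num -> b \is a fin_num ->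
    c \is a fin_num -> (a + b = (c + b) + (a - c))%E.
  move=> fa fb fc; rewrite -(fineK fa) -(fineK fb) -(fineK fc).
  by rewrite -!EFinD; congr EFin; ring.
(* [D] is nonnegative on [A], so [P] is the smaller measure there and [Q] is the smaller one on [N].
   The remainders [P - m] and [Q - m] are thus the negative and positive Jordan parts of [Q - P],
   which are already measures. *)
pose p : {measure set S -> \bar R} := jordan_neg hAN.
pose q : {measure set S -> \bar R} := jordan_pos hAN.
have mI B : measurable B -> measurable (B `&` A) /\ measurable (B `&` N).
  by move=> mB; split; exact: measurableI.
have pE B : measurable B -> p B = (P (B `&` N) - Q (B `&` N))%E.
  move=> mB; have [_ mBN] := mI _ mB.
  rewrite [LHS]jordan_negE cjordan_negE /crestr0 mem_set// /crestr DE.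
  rewrite oppeB.
  by rewrite addeC.
  by apply: fin_num_adde_defr; exact: fin.
have qE B : measurable B -> q B = (Q (B `&` A) - P (B `&` A))%E.
  by move=> mB; rewrite [LHS]jordan_posE cjordan_posE /crestr0 mem_set// /crestr DE.
exists m, p, q, A; split => //.
- by move=> B mB; rewrite mE NE.
- move=> B mB; have [mBA mBN] := mI _ mB.
  rewrite mE (split_AN P)// pE// [LHS]addeC (addeC (P (B `&` A))).
  by apply: fin_sub; exact: fin.
- move=> B mB; have [mBA mBN] := mI _ mB.
  rewrite mE (split_AN Q)// qE//.
  by apply: fin_sub; exact: fin.
Qed.

Section extreme_measures.
Context {R : realType} {X : pmetricType R} {G : topSemigroupType}.
Context {T : G -> X -> X}.
Local Notation M := (invariant_measure T).
Implicit Types (g : G) (mu nu rho : M) (A B : set (borel X)).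
Hypothesis XT : dynamical_system T.

Let prob_fin mu (A : set (borel X)) : measurable A -> prob_of mu A \is a fin_num.
Proof. by move=> mA; exact: fin_num_measure. Qed.

Let mT g (A : set (borel X)) :
  measurable A -> measurable (T g @^-1` A : set (borel X)).
Proof.
move=> mA; rewrite -[X in measurable X]setTI; exact: borel_measurable_action.
Qed.

Lemma meet_invariant mu nu (m : {measure set (borel X) -> \bar R}) A :
  measurable A ->
  (forall B, measurable B ->
    m B = (prob_of mu (B `&` A) + prob_of nu (B `&` ~` A))%E) ->
  (forall B, measurable B -> (m B <= prob_of mu B)%E) ->
  (forall B, measurable B -> (m B <= prob_of nu B)%E) ->
  forall g B, measurable B -> m (T g @^-1` B) = m B.
Proof.
move=> mA mE m_mu m_nu g.
have mfin (B : set (borel X)) : measurable B -> m B \is a fin_num.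
  move=> mB; rewrite ge0_fin_numE//; apply: le_lt_trans (m_mu _ mB) _.
  by rewrite -ge0_fin_numE// prob_fin.
have le_m (B : set (borel X)) : measurable B -> (m (T g @^-1` B) <= m B)%E.
  move=> mB; have mBA : measurable (B `&` A) by exact: measurableI.
  have mBN : measurable (B `&` ~` A).
    by apply: measurableI => //; exact: measurableC.
  rewrite [leRHS]mE//.
  rewrite (_ : T g @^-1` B = T g @^-1` (B `&` A) `|` T g @^-1` (B `&` ~` A)).
    rewrite measureU; [|exact: mT|exact: mT|]; last first.
      by rewrite -preimage_setI setIACA setICr setI0 preimage_set0.
    apply: leeD.
      by apply: le_trans (m_mu _ (mT g mBA)) _; rewrite prob_of_invariant.
    by apply: le_trans (m_nu _ (mT g mBN)) _; rewrite prob_of_invariant.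
  by rewrite -preimage_setU -setIUr setUCr setIT.
move=> B mB; apply/eqP; rewrite eq_le le_m//=.
have mC : measurable (~` B) by exact: measurableC.
have mTC (C : set (borel X)) : measurable C -> (m C + m (~` C) = m setT)%E.
  move=> mC'; rewrite -measureU; [by rewrite setUCr| by []|exact: measurableC|].
  by rewrite setICr.
have := le_m _ mC; rewrite preimage_setC.
have := mTC _ mB; rewrite -(mTC _ (mT g mB)).
rewrite -(fineK (mfin _ mB)) -(fineK (mfin _ mC)) -(fineK (mfin _ (mT g mB))).
rewrite -(fineK (mfin _ (measurableC (mT g mB)))) -!EFinD !lee_fin => -[h1] h2.
lra.
Qed.

(** Let [c] be the mass of the infimum of the two measures. If [c = 0] they are singular. Otherwise
    the normalized infimum is an invariant component of [mu], so by extremality it is [mu]; it is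
    also a component of [nu] with the same weight [c]. *)
Lemma extreme_not_singular mu nu : extreme_measure mu ->
  (exists2 A, measurable A & prob_of mu A = 0%E /\ prob_of nu (~` A) = 0%E) \/
  exists2 c : R, 0 < c <= 1 & exists rho, mixture c mu rho nu.
Proof.
move=> ext.
have [m [p [q [A [mA mE muE nuE]]]]] := measure_meet (prob_of mu) (prob_of nu).
have m_mu (B : set (borel X)) : measurable B -> (m B <= prob_of mu B)%E.
  by move=> mB; rewrite muE// leeDl.
have m_nu (B : set (borel X)) : measurable B -> (m B <= prob_of nu B)%E.
  by move=> mB; rewrite nuE// leeDl.
have minv := meet_invariant mA mE m_mu m_nu.
have mfin (B : set (borel X)) : measurable B -> m B \is a fin_num.
  move=> mB; rewrite ge0_fin_numE//; apply: le_lt_trans (m_mu _ mB) _.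
  by rewrite -ge0_fin_numE// prob_fin.
have addIe (a x y : \bar R) : a \is a fin_num -> (a + x = a + y)%E -> x = y.
  by move=> fa axy; rewrite -(addeK x fa) -(addeK y fa) -!(addeC a) axy.
have rem_inv (k : {measure set (borel X) -> \bar R}) (lam : M) :
    (forall B, measurable B -> prob_of lam B = (m B + k B)%E) ->
    forall g B, measurable B -> k (T g @^-1` B) = k B.
  move=> kE g B mB; have := kE _ (mT g mB).
  rewrite prob_of_invariant// kE// minv// => /esym.
  by apply: addIe; exact: mfin.
have [c cE] : exists c : R, m setT = c%:E.
  by exists (fine (m setT)); rewrite fineK// mfin.
have c_ge0 : 0 <= c by rewrite -lee_fin -cE.
have c_le1 : c <= 1.
  by rewrite -lee_fin -cE -(probability_setT (prob_of mu)); exact: m_mu.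
have remT (k : {measure set (borel X) -> \bar R}) (lam : M) :
    (forall B, measurable B -> prob_of lam B = (m B + k B)%E) ->
    k setT = (1 - c)%:E.
  move=> kE; have := kE setT measurableT; rewrite probability_setT cE => h.
  have : (c%:E + k setT = c%:E + (1 - c)%:E)%E.
    by rewrite -h -EFinD; congr EFin; ring.
  exact: addIe.
have [c0|c_gt0] := eqVneq c 0.
  left; exists A => //.
  have : (prob_of mu A + prob_of nu (~` A) = 0)%E.
    by have := mE setT measurableT; rewrite !setTI cE c0 => <-.
  by move/eqP; rewrite padde_eq0// => /andP[/eqP -> /eqP ->].
have {c_ge0}c_gt0 : 0 < c by rewrite lt_neqAle eq_sym c_gt0.
right; exists c; first by rewrite c_gt0.
have [kap kapE] := normalized_invariant mu c_gt0 cE minv.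
have mkap (B : set (borel X)) : (m B = c%:E * prob_of kap B)%E.
  by rewrite kapE muleC -muleA -EFinM mulVf ?mule1// gt_eqF.
have rem0 (k : {measure set (borel X) -> \bar R}) (lam : M) :
    (forall B, measurable B -> prob_of lam B = (m B + k B)%E) -> c = 1 ->
    forall B, measurable B -> m B = prob_of lam B.
  move=> kE c1 B mB; rewrite kE// (_ : k B = 0%E) ?adde0//.
  apply/eqP; rewrite eq_le measure_ge0 andbT.
  have -> : 0%E = k setT by rewrite (remT _ _ kE) c1 subrr.
  by apply: le_measure; rewrite ?inE.
(* For [c = 1] the remainders have mass 0 and cannot be normalized; both measures then agree with
   [m] on Borel sets, and any second component will do. *)
have [c1|c_neq1] := eqVneq c 1.
  exists mu => B mB; rewrite c1 subrr mul0e adde0 mul1e.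
  by rewrite -(rem0 _ _ muE c1)// (rem0 _ _ nuE c1).
have c_lt1 : 0 < 1 - c by rewrite subr_gt0 lt_neqAle c_neq1.
have rem_mix (k : {measure set (borel X) -> \bar R}) (lam : M) :
    (forall B, measurable B -> prob_of lam B = (m B + k B)%E) ->
    exists rho, mixture c kap rho lam.
  move=> kE.
  have [rho rhoE] := normalized_invariant mu c_lt1 (remT _ _ kE) (rem_inv _ _ kE).
  exists rho => B mB; rewrite kE// mkap; congr (_ + _)%E.
  by rewrite rhoE muleC -muleA -EFinM mulVf ?mule1// gt_eqF.
have [rho mix] := rem_mix _ _ muE.
have kap_mu := ext c kap rho _ mix.
have [rho' mix'] := rem_mix _ _ nuE.
exists rho' => B mB; rewrite mix'// kap_mu//.
by rewrite c_gt0 -subr_gt0.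
Qed.

End extreme_measures.

(** * Separating an extreme measure from singular ones *)

Section separation.
Context {R : realType} {X : pmetricType R} {G : topSemigroupType}.
Context {T : G -> X -> X}.
Local Notation M := (invariant_measure T).
Implicit Types (f : X -> R) (mu nu rho : M).
Hypothesis XT : dynamical_system T.

Let cX : compact [set: X]. Proof. by case: XT. Qed.

Let prob_fin mu : (prob_of mu setT < +oo)%E.
Proof. by rewrite probability_setT ltry. Qed.

Definition singular mu nu := exists2 A : set (borel X), measurable A &
  prob_of mu A = 0%E /\ prob_of nu (~` A) = 0%E.

Definition peak mu (d : R) f := [/\ continuous f, forall x, 0 <= f x <= 1
  & 1 - d <= mean mu f].

Lemma singular_peak mu nu (d : R) : singular mu nu -> 0 < d ->
  exists2 f, peak mu d f & mean nu f <= d.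
Proof.
move=> [A mA [muA nuA]] d0; have mC : measurable (~` A) by exact: measurableC.
have [f [cf f01]] := borel_approx_continuous cX (prob_fin mu) (prob_fin nu) mC d0.
have -> : fine (prob_of nu (~` A)) = 0 by rewrite nuA.
have -> : fine (prob_of mu (~` A)) = 1.
  by have := probability_setC (prob_of mu) mA; rewrite muA sube0 => ->.
rewrite subr0 !ler_norml => /andP[mu1 _] /andP[_ nu0].
by exists f => //; split => //; rewrite /mean; lra.
Qed.

Lemma mean_sum (n : nat) (a : nat -> R) (F : nat -> X -> R) :
  (forall i, continuous (F i)) ->
  continuous (fun x => \sum_(i < n) a i * F i x) /\
  forall nu, mean nu (fun x => \sum_(i < n) a i * F i x) =
             \sum_(i < n) a i * mean nu (F i).
Proof.
move=> cF; elim: n => [|n [cS IH]].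
  under eq_fun do rewrite big_ord0; split=> [|nu]; first exact: cst_continuous.
  by rewrite big_ord0 mean_cst.
have -> : (fun x => \sum_(i < n.+1) a i * F i x) =
    (fun x => a n * F n x + \sum_(i < n) a i * F i x).
  by apply/funext => x; rewrite big_ord_recr addrC.
split=> [x|nu].
  by apply: cvgD; [apply: cvgM; [exact: cvg_cst|exact: cF]|exact: cS].
by rewrite mean_linear// IH [RHS]big_ord_recr addrC.
Qed.

(** First-order expansion of the squared positive part, with an explicit quadratic remainder; it
    replaces differentiation in the variational argument below. *)
Lemma sqr_pos_part (x y : R) :
  Num.max 0 (x - y) ^+ 2 <= Num.max 0 x ^+ 2 - 2 * Num.max 0 x * y + y ^+ 2.
Proof.
have [x0|x0] := leP 0 x; have [y0|y0] := leP 0 (x - y).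
- by rewrite le_eqVlt; apply/orP; left; apply/eqP; ring.
- have -> : x ^+ 2 - 2 * x * y + y ^+ 2 = (x - y) ^+ 2 by ring.
  by rewrite expr0n/= sqr_ge0.
- rewrite mulr0 mul0r subr0 expr0n/= add0r -subr_ge0.
  have -> : y ^+ 2 - (x - y) ^+ 2 = x * (y + (y - x)) by ring.
  by rewrite nmulr_rge0//; lra.
- by rewrite mulr0 mul0r subr0 expr0n/= add0r sqr_ge0.
Qed.

Definition convex_measures (F : set M) := forall (t : R) nu rho,
  0 <= t <= 1 -> F nu -> F rho -> exists2 k, F k & mixture t nu rho k.

(* Minimize the sum of the [(d - mean nu (u i))^+ ^ 2]: at a minimizer with
   positive value, the first variation in the direction of a measure good for
   the average of the [u i] weighted by the defects would be negative. *)
Lemma convex_common_level (F : set M) (d : R) (n : nat) (u : nat -> X -> R) :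
  closed F -> convex_measures F -> (forall i, continuous (u i)) -> F !=set0 ->
  (forall w : nat -> R, (forall i, 0 <= w i) -> 0 < \sum_(i < n) w i ->
     exists2 nu, F nu &
       d * \sum_(i < n) w i <= \sum_(i < n) w i * mean nu (u i)) ->
  exists2 nu, F nu & forall i, (i < n)%N -> d <= mean nu (u i).
Proof.
move=> cF convF cu F0 good.
pose def nu i := Num.max 0 (d - mean nu (u i)).
pose Q nu := \sum_(i < n) def nu i ^+ 2.
have cQ : continuous Q.
  rewrite /Q; elim: n {good Q} => [|m IH].
    rewrite (_ : (fun _ => _) = cst 0); first exact: cst_continuous.
    by apply/funext => nu; rewrite big_ord0.
  have cdef : continuous (fun nu => def nu m).
    move=> nu; apply: (@continuous_max R M (cst 0) (fun nu => d - mean nu (u m))).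
      exact: cst_continuous.
    apply: (@continuousB _ R M (cst d) (fun nu => mean nu (u m))).
      exact: cst_continuous.
    exact: mean_continuous.
  rewrite (_ : (fun _ => _) =
    (fun nu => \sum_(i < m) def nu i ^+ 2 + def nu m * def nu m)).
    move=> nu; apply: (@continuousD _ R M (fun nu => \sum_(i < m) def nu i ^+ 2)
      (fun nu => def nu m * def nu m)); first exact: IH.
    by apply: continuousM; exact: cdef.
  by apply/funext => nu; rewrite big_ord_recr /= expr2.
have kF : compact F by apply: (subclosed_compact cF (compact_invariant_measures XT)).
have [|nu0] := compact_EVT_min F0 kF (f := Q); first exact: continuous_subspaceT.
rewrite inE => Fnu0 minQ.
exists nu0 => // i ilt.
pose w := def nu0.
have w0 j : 0 <= w j by rewrite /w /def le_max lexx.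
have [wsum|wsum] := leP (\sum_(i < n) w i) 0.
  have /eqP : \sum_(j < n) w j = 0.
    by apply/eqP; rewrite eq_le wsum sumr_ge0.
  rewrite psumr_eq0// => /allP/(_ (Ordinal ilt)).
  rewrite mem_index_enum => /(_ isT)/= /eqP wi.
  have : d - mean nu0 (u i) <= w i by rewrite /w /def le_max lexx orbT.
  by rewrite wi subr_le0.
exfalso; have [nu1 Fnu1 nu1P] := good _ w0 wsum.
pose D j := mean nu1 (u j) - mean nu0 (u j).
pose S := \sum_(j < n) w j ^+ 2.
have S0 : 0 < S.
  rewrite lt_neqAle sumr_ge0 ?andbT; last by move=> j _; rewrite sqr_ge0.
  rewrite eq_sym; apply/eqP => /eqP.
  rewrite psumr_eq0; last by move=> j _; rewrite sqr_ge0.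
  move/allP => S0; move: wsum; rewrite big1 ?ltxx// => j _.
  by apply/eqP; have := S0 j (mem_index_enum j); rewrite /= expf_eq0.
(* Wherever the weight [w j] is nonzero it equals [d - mean nu0 (u j)], which rewrites the sum of
   squares [S] as a weighted sum of defects. *)
have SwD : S <= \sum_(j < n) w j * D j.
  have -> : \sum_(j < n) w j * D j =
      \sum_(j < n) w j * mean nu1 (u j) - \sum_(j < n) w j * mean nu0 (u j).
    by rewrite -sumrB; apply: eq_bigr => j _; rewrite mulrBr.
  have -> : S = d * \sum_(i < n) w i - \sum_(j < n) w j * mean nu0 (u j).
    rewrite mulr_sumr -sumrB; apply: eq_bigr => j _.
    rewrite [d * _]mulrC -mulrBr expr2 /w /def.
    by have [h|h] := leP 0 (d - mean nu0 (u j)); rewrite ?mul0r.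
  by rewrite lerB.
pose N := \sum_(j < n) D j ^+ 2.
have N0 : 0 <= N by rewrite sumr_ge0// => j _; rewrite sqr_ge0.
have variation (t : R) : 0 <= t <= 1 ->
    0 <= - (2 * t * \sum_(j < n) w j * D j) + t ^+ 2 * N.
  move=> t01; have [k Fk mixk] := convF t nu1 nu0 t01 Fnu1 Fnu0.
  have : Q nu0 <= Q k by apply: minQ; rewrite inE.
  have -> : - (2 * t * \sum_(j < n) w j * D j) + t ^+ 2 * N =
      \sum_(j < n) (w j ^+ 2 - 2 * w j * (t * D j) + (t * D j) ^+ 2) - Q nu0.
    rewrite /N !mulr_sumr -sumrN -big_split/= -sumrB; apply: eq_bigr => j _.
    by rewrite /w; ring.
  move=> Q0k; rewrite subr_ge0; apply: (le_trans Q0k); apply: ler_sum => j _.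
  apply: le_trans (sqr_pos_part _ _); rewrite /def (mixture_mean XT t01 mixk)//.
  rewrite le_eqVlt; apply/orP; left; apply/eqP; congr (Num.max _ _ ^+ 2).
  by rewrite /D; ring.
(* This choice gives [t * N <= S], so the variation is at most [t * (S - 2 * S)], which is negative.
   The denominator [N + 1] avoids division by 0. *)
pose t := Num.min 1 (S / (N + 1)).
have N1 : 0 < N + 1 by lra.
have t0 : 0 < t by rewrite lt_min ltr01 divr_gt0.
have t1 : t <= 1 by rewrite ge_min lexx.
have tN : t * N <= S.
  have : t * (N + 1) <= S by rewrite -ler_pdivlMr// ge_min lexx orbT.
  by nra.
have t01 : 0 <= t <= 1 by rewrite t1 ltW.
have := variation t t01; rewrite expr2 -mulrA.
have -> : - (2 * (t * \sum_(j < n) w j * D j)) + t * t * N =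
          t * (t * N - 2 * \sum_(j < n) w j * D j) by ring.
by rewrite pmulr_rge0//; lra.
Qed.

(** If no peak function works, each one has mean at least [d] at some measure of [F]. Averages of
    peak functions are peak functions, so [convex_common_level] provides a common measure for any
    finite family, and compactness provides one for all of them. That measure is singular to [mu],
    so some peak function has mean at most [d / 2] there. *)
Lemma convex_separation mu (F : set M) (d : R) :
  closed F -> convex_measures F -> 0 < d -> (forall nu, F nu -> singular mu nu) ->
  exists2 f, peak mu d f & forall nu, F nu -> mean nu f < d.
Proof.
move=> cF convF d0 singF; apply: contrapT => nosep.
have good f : peak mu d f -> exists2 nu, F nu & d <= mean nu f.
  move=> bf; apply: contrapT => h; apply: nosep; exists f => // nu Fnu.
  by rewrite ltNge; apply/negP => df; apply: h; exists nu.
have peak1 : peak mu d (fun=> 1).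
  split; [exact: cst_continuous|by move=> x; rewrite ler01 lexx|].
  by rewrite mean_cst gerBl ltW.
have F0 : F !=set0 by have [nu Fnu _] := good _ peak1; exists nu.
(* A pair [(n, u)] codes the finite family [u 0, ..., u (n - 1)]; concatenation of families makes
   the level sets directed. *)
pose D := [set s : nat * (nat -> X -> R) | forall i, peak mu d (s.2 i)].
pose P (s : nat * (nat -> X -> R)) :=
  F `&` \bigcap_(i in `I_s.1) [set nu | d <= mean nu (s.2 i)].
have : \bigcap_(s in D) P s !=set0.
  apply: compact_directed_bigcap; first exact: compact_invariant_measures.
  - by exists (0%N, fun _ _ => 1) => i; exact: peak1.
  - move=> [n1 u1] [n2 u2] /= D1 D2.
    exists ((n1 + n2)%N, fun i => if (i < n1)%N then u1 i else u2 (i - n1)%N).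
      by move=> i /=; case: ifP.
    move=> nu [Fnu nuP]; split; split => // i /= ilt.
      by have := nuP i; rewrite /= ilt; apply; exact: ltn_addr.
    have := nuP (n1 + i)%N; rewrite /= ltn_add2l addKn.
    by rewrite [X in if X then _ else _]ltnNge leq_addr; apply.
  - move=> s Ds; apply: closedI => //; apply: closed_bigI => i _.
    have [cu _ _] := Ds i.
    apply: (@closed_comp _ _ (fun nu => mean nu (s.2 i)) [set r | d <= r]) => [nu _|].
      exact: mean_continuous.
    exact: closed_ge.
  - move=> [n u] /= Du.
    have cu i : continuous (u i) by have [] := Du i.
    have [|nu Fnu nuP] := convex_common_level (n := n) cF convF cu F0 (d := d).
      move=> w w0 W0; set W := \sum_(i < n) w i in W0 *.
      pose f x := \sum_(i < n) (w i / W) * u i x.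
      have [cf meanf] := mean_sum n (fun i => w i / W) cu.
      have wW0 i : 0 <= w i / W by rewrite divr_ge0// ltW.
      have wW1 : \sum_(i < n) w i / W = 1 by rewrite -mulr_suml divff// gt_eqF.
      have avg_le (a b : nat -> R) : (forall i, a i <= b i) ->
          \sum_(i < n) (w i / W) * a i <= \sum_(i < n) (w i / W) * b i.
        by move=> ab; apply: ler_sum => i _; exact: ler_wpM2l.
      have avg_cst (c : R) : \sum_(i < n) (w i / W) * c = c.
        by rewrite -mulr_suml wW1 mul1r.
      have bf : peak mu d f.
        split => //.
          move=> x; rewrite -[leLHS](avg_cst 0) -[X in _ && (_ <= X)](avg_cst 1).
          apply/andP; split; [apply: (avg_le (cst 0) (u ^~ x))|
            apply: (avg_le (u ^~ x) (cst 1))] => i;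
          by have [_ /(_ x)/andP[]] := Du i.
        rewrite meanf -[leLHS]avg_cst.
        apply: (avg_le (cst (1 - d)) (fun i => mean mu (u i))) => i.
        by have [] := Du i.
      have [nu Fnu dnu] := good _ bf; exists nu => //.
      move: dnu; rewrite meanf -(ler_pM2r W0) mulr_suml => /le_trans; apply.
      rewrite le_eqVlt; apply/orP; left; apply/eqP; apply: eq_bigr => i _.
      by rewrite mulrAC divfK// gt_eqF.
    by exists nu; split => // i /= /nuP.
move=> [nu nuP].
have [[Fnu _] _] : P (0%N, fun _ _ => 1) nu /\ True by split => //; apply: nuP.
have [|f [cf f01 fmu] fnu] := singular_peak (singF _ Fnu) (d := d / 2).
  by rewrite divr_gt0.
have bf : peak mu d f by split => //; apply: le_trans fmu; lra.
have [_ /(_ 0%N isT)/=] : P (1%N, fun _ => f) nu by apply: nuP.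
by lra.
Qed.

End separation.

(** * Descent to a freezing potential *)

(* Ekeland's variational principle: descent steps chosen of almost maximal length
   have finite total length, and their limit admits no further step. *)
Lemma uniform_descent (R : realType) (X : topologicalType) (J : (X -> R) -> R) :
  (forall f, continuous f -> 0 <= J f) ->
  (forall f g (c : R), continuous f -> continuous g ->
    (forall x, `|f x - g x| <= c) -> J f <= J g + 2 * c) ->
  (forall f, continuous f -> 0 < J f -> exists (t : R) (g : X -> R),
    [/\ 0 < t, continuous g, forall x, `|g x - f x| <= t & J g <= J f - t / 2]) ->
  forall f0, continuous f0 -> exists f, [/\ continuous f,
    forall x, `|f x - f0 x| <= 2 * J f0 & J f = 0].
Proof.
move=> J0 Jlip descent f0 cf0.
pose step (f : X -> R) := [set t : R | 0 <= t /\ exists g : X -> R,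
  [/\ continuous g, forall x, `|g x - f x| <= t & J g <= J f - t / 2]].
have step0 f : continuous f -> step f 0.
  move=> cf; split => //; exists f.
  by split => // [x|]; rewrite ?subrr ?normr0// mul0r subr0.
have step_sup f : continuous f -> has_sup (step f).
  move=> cf; split; first by exists 0; exact: step0.
  exists (2 * J f) => t [_ [g [cg _ Jg]]]; have := J0 g cg; lra.
(* The chosen step is at least half the supremum of the admissible lengths. That supremum is finite
   because [J] is nonnegative; when it is 0 the sequence stays put. *)
have next (f : X -> R) : exists p : (X -> R) * R, continuous f ->
    [/\ continuous p.1, forall x, `|p.1 x - f x| <= p.2,
        J p.1 <= J f - p.2 / 2, 0 <= p.2 & forall t, step f t -> t <= 2 * p.2].
  have [cf|cf] := pselect (continuous f); last by exists (f, 0).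
  have [s0|s0] := leP (sup (step f)) 0.
    have [_ [g [cg gf Jg]]] := step0 _ cf.
    exists (g, 0) => _; split => // t st; rewrite mulr0; apply: le_trans s0.
    by apply: ub_le_sup => //; have [] := step_sup _ cf.
  have s20 : 0 < sup (step f) / 2 by rewrite divr_gt0.
  have [t [t0 [g [cg gf Jg]]] st] := sup_adherent s20 (step_sup _ cf).
  exists (g, t) => _; split => // r sr.
  have : r <= sup (step f) by apply: ub_le_sup => //; have [] := step_sup _ cf.
  by move: st; rewrite /=; lra.
have [nx nxP] := choice next.
pose F n := iter n (fun f => (nx f).1) f0.
have cF n : continuous (F n) by elim: n => // n cFn; have [] := nxP _ cFn.
pose a n := J (F n).
have a0 n : 0 <= a n by exact: J0.
have FS n : [/\ forall x, `|F n.+1 x - F n x| <= 2 * (a n - a n.+1),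
    a n.+1 <= a n & forall t, step (F n) t -> t <= 4 * (a n - a n.+1)].
  have [_ Fn Jn p0 sn] := nxP _ (cF n).
  have {}Jn : (nx (F n)).2 <= 2 * (a n - a n.+1) by rewrite /a /=; lra.
  split.
  - by move=> x; apply: le_trans (Fn x) Jn.
  - lra.
  - by move=> t /sn; lra.
have a_dec m n : (m <= n)%N -> a n <= a m.
  move=> mn; rewrite -(subnK mn); elim: (n - m)%N => // k.
  by rewrite addSn; have [_ + _] := FS (k + m)%N => /le_trans; apply.
(* Each move is at most twice the drop of [a], so adding [2 * a n] makes the sequence nonincreasing
   at every point. The limit is then an infimum, corrected by [2 * al]. *)
pose u x n := F n x + 2 * a n.
have u_dec x m n : (m <= n)%N -> u x n <= u x m.
  move=> mn; rewrite -(subnK mn); elim: (n - m)%N => // k.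
  rewrite addSn; apply: le_trans; have [/(_ x) + _ _] := FS (k + m)%N.
  by rewrite ler_norml /u => /andP[_]; lra.
have F_low x m n : (m <= n)%N -> F m x - 2 * (a m - a n) <= F n x.
  move=> mn; rewrite -(subnK mn); elim: (n - m)%N => [|k].
    by rewrite subrr mulr0 subr0.
  rewrite addSn; have [/(_ x) + _ _] := FS (k + m)%N.
  by rewrite ler_norml => /andP[+ _]; lra.
pose al := inf (range a).
have a_inf : has_inf (range a).
  by split; [exists (a 0%N), 0%N|exists 0 => _ [n _ <-]].
have al_le n : al <= a n by apply: ge_inf; [have [] := a_inf|exists n].
have al_ge0 : 0 <= al by apply: lb_le_inf; [have [] := a_inf|move=> _ [n _ <-]].
have al_near (e : R) : 0 < e -> exists n, a n < al + e.
  by move=> e0; have [_ [n _ <-] h] := inf_adherent e0 a_inf; exists n.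
have u_low x m n : F n x - 2 * a n + 4 * al <= u x m.
  have [mn|nm] := leqP m n.
    apply: le_trans (u_dec x _ _ mn); rewrite /u; have := al_le n; lra.
  have := F_low x _ _ (ltnW nm); have := al_le m; rewrite /u; lra.
have u_inf x : has_inf (range (u x)).
  split; first by exists (u x 0%N), 0%N.
  by exists (F 0%N x - 2 * a 0%N + 4 * al) => _ [m _ <-].
pose f x := inf (range (u x)) - 2 * al.
have fF x n : `|f x - F n x| <= 2 * (a n - al).
  have h1 : inf (range (u x)) <= u x n.
    by apply: ge_inf; [have [] := u_inf x|exists n].
  have h2 : F n x - 2 * a n + 4 * al <= inf (range (u x)).
    by apply: lb_le_inf; [have [] := u_inf x|move=> _ [m _ <-]].
  by rewrite ler_norml /f; apply/andP; rewrite /u in h1; split; lra.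
have cf : continuous f.
  move=> x; apply/cvgrPdist_le => e e0.
  have [|n an] := al_near (e / 8); first by rewrite divr_gt0.
  have : \forall y \near x, `|F n x - F n y| <= e / 2.
    by move/cvgrPdist_le : (cF n x); apply; rewrite divr_gt0.
  apply: filterS => y; have := fF x n; have := fF y n.
  rewrite !ler_norml => /andP[? ?] /andP[? ?] /andP[? ?]; apply/andP; split; lra.
have Jf : J f <= al.
  apply/ler_addgt0Pr => e e0.
  (* The Lipschitz bound at distance [2 * (a n - al)] costs [4 * (a n - al)], and [a n] itself
     exceeds [al] by one more such term: five in all. *)
  have [|n an] := al_near (e / 5); first by rewrite divr_gt0.
  have := Jlip _ _ _ cf (cF n) (fF ^~ n); rewrite -/(a n); lra.
exists f; split => //.
  by move=> x; apply: le_trans (fF x 0%N) _; rewrite /a /=; lra.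
apply/eqP; rewrite eq_le J0// andbT leNgt; apply/negP => /(descent _ cf).
move=> [t [g [t0 cg gf Jg]]].
have [|n an] := al_near (t / 4); first by rewrite divr_gt0.
(* A step of length [t] from the limit is a step of length [t + 2 * (a n - al)] from [F n]. Once
   [a n - al < t / 4] this exceeds the maximal length allowed at stage [n]. *)
have [_ an1 /(_ (t + 2 * (a n - al)))] := FS n.
have -> : (t + 2 * (a n - al) <= 4 * (a n - a n.+1)) = false.
  by apply/negbTE; rewrite -ltNge; have := al_le n; have := al_le n.+1; lra.
have aln := al_le n.
have st : step (F n) (t + 2 * (a n - al)).
  split; first lra.
  exists g; split => //; last by rewrite -/(a n); lra.
  move=> x; have := fF x n; have := gf x.
  by rewrite !ler_norml => /andP[? ?] /andP[? ?]; apply/andP; split; lra.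
by move=> /(_ st).
Qed.

(** * The excess over an extreme measure *)

Section freezing.
Context {R : realType} {X : pmetricType R} {G : topSemigroupType}.
Context {T : G -> X -> X}.
Local Notation M := (invariant_measure T).
Implicit Types (f : X -> R) (v : M -> R) (mu nu rho : M).
Hypothesis XT : dynamical_system T.

Let cX : compact [set: X]. Proof. by case: XT. Qed.

Definition usc v :=
  forall nu (r : R), v nu < r -> \forall rho \near nu, v rho < r.

Definition mixture_affine v := forall (t : R) mu nu rho, 0 <= t <= 1 ->
  mixture t mu nu rho -> v rho = t * v mu + (1 - t) * v nu.

Lemma usc_superlevel_closed v (r : R) : usc v -> closed [set nu | r <= v nu].
Proof.
move=> uv; rewrite -openC.
have -> : ~` [set nu | r <= v nu] = [set nu | v nu < r].
  by apply/seteqP; split=> nu /=; rewrite ltNge => /negP.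
by rewrite openE => nu /= /uv.
Qed.

(* If [v] reached the level [J] at a measure with [mu] as a convex component, then
   [v mu] would be [J] and not [0]. *)
Lemma affine_level_peak v mu (J d : R) : usc v -> mixture_affine v ->
  extreme_measure mu -> v mu = 0 -> (forall nu, v nu <= J) -> 0 < J -> 0 < d ->
  exists2 g, peak mu d g & forall nu, J <= v nu -> mean nu g < d.
Proof.
move=> uv av ext vmu vJ J0 d0.
apply: (convex_separation XT (F := [set nu | J <= v nu])) => //.
- exact: usc_superlevel_closed.
- move=> t nu rho t01 vnu vrho; have [k mixk] := mixture_ex nu rho t01.
  exists k => //=; rewrite (av _ _ _ _ t01 mixk).
  have -> : J = t * J + (1 - t) * J by ring.
  by move/andP: t01 => [t0 t1]; rewrite lerD// ler_wpM2l// subr_ge0.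
move=> nu /= vnu.
have [//|[c /andP[c0 c1] [rho mix]]] := extreme_not_singular XT nu ext.
have c01 : 0 <= c <= 1 by rewrite c1 ltW.
exfalso; have := av _ _ _ _ c01 mix; rewrite vmu mulr0 add0r.
have : (1 - c) * v rho <= (1 - c) * J by rewrite ler_wpM2l// subr_ge0.
have : 0 < c * J by rewrite mulr_gt0.
lra.
Qed.

Lemma mean_affine f : continuous f -> mixture_affine (mean ^~ f).
Proof. by move=> cf t mu nu rho t01 mix; exact: mixture_mean. Qed.

Lemma continuous_usc v : continuous v -> usc v.
Proof. by move=> cv nu r vr; exact: (cvgr_lt _ (cv nu)). Qed.

Lemma uscD v1 v2 : usc v1 -> usc v2 -> usc (fun nu => v1 nu + v2 nu).
Proof.
move=> u1 u2 nu r vr; pose e := (r - (v1 nu + v2 nu)) / 2.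
have e0 : 0 < e by rewrite divr_gt0// subr_gt0.
have n1 := u1 nu (v1 nu + e); have n2 := u2 nu (v2 nu + e).
rewrite ltrDl in n1; rewrite ltrDl in n2.
by apply: filterS2 (n1 e0) (n2 e0) => rho; rewrite /e; lra.
Qed.

(** In the application [k nu] is [s * (h nu - h mu)] and [C] is [s] times a bound on the entropy. *)
Variables (k : M -> R) (mu : M) (C : R).
Hypotheses (usc_k : usc k) (aff_k : mixture_affine k) (k_mu : k mu = 0).
Hypotheses (k_le : forall nu, k nu <= C) (ext_mu : extreme_measure mu).

Let v0 f nu := mean nu f - mean mu f.
Let v1 f nu := v0 f nu + k nu.

Let usc_v0 f : continuous f -> usc (v0 f).
Proof.
move=> cf; apply: continuous_usc => nu.
apply: (@continuousB _ R M (fun nu => mean nu f) (cst (mean mu f))).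
  exact: mean_continuous.
exact: cst_continuous.
Qed.

Let usc_v1 f : continuous f -> usc (v1 f).
Proof. by move=> cf; apply: uscD => //; exact: usc_v0. Qed.

Let aff_v0 f : continuous f -> mixture_affine (v0 f).
Proof.
move=> cf t nu rho lam t01 mix; rewrite /v0 (mean_affine cf t01 mix); ring.
Qed.

Let aff_v1 f : continuous f -> mixture_affine (v1 f).
Proof.
move=> cf t nu rho lam t01 mix.
by rewrite /v1 (aff_v0 cf t01 mix) (aff_k t01 mix); ring.
Qed.

Let value f nu := v0 f nu + Num.max 0 (k nu).

Let valueE f nu : value f nu = Num.max (v0 f nu) (v1 f nu).
Proof. by rewrite /value addr_maxr addr0. Qed.

Definition excess f := sup [set value f nu | nu in [set: M]].

Let C_ge0 : 0 <= C. Proof. by rewrite -k_mu. Qed.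

Let has_sup_value f : continuous f -> has_sup [set value f nu | nu in [set: M]].
Proof.
move=> cf; split; first by exists (value f mu), mu.
have [c c0 fc] := continuous_compact_bounded cX cf.
exists (2 * c + C) => _ [nu _ <-].
have := mean_bound XT nu cf fc; have := mean_bound XT mu cf fc.
have : Num.max 0 (k nu) <= C by rewrite ge_max C_ge0 k_le.
rewrite !ler_norml /value /v0 => ? /andP[? ?] /andP[? ?]; lra.
Qed.

Lemma value_le_excess f nu : continuous f -> value f nu <= excess f.
Proof.
by move=> cf; apply: ub_le_sup; [have [] := has_sup_value cf|exists nu].
Qed.

Lemma excess_le f (r : R) : continuous f -> (forall nu, value f nu <= r) ->
  excess f <= r.
Proof.
move=> cf h; apply: ge_sup; first by have [] := has_sup_value cf.
by move=> _ [nu _ <-].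
Qed.

Lemma excess_ge0 f : continuous f -> 0 <= excess f.
Proof.
move=> cf; apply: le_trans (value_le_excess mu cf).
by rewrite /value /v0 subrr add0r k_mu maxxx.
Qed.

Lemma mean_add nu f g : continuous f -> continuous g ->
  mean nu (fun x => f x + g x) = mean nu f + mean nu g.
Proof.
move=> cf cg; have := mean_linear XT nu 1 cf cg; rewrite mul1r => <-.
by congr mean; apply/funext => x; rewrite mul1r.
Qed.

Lemma excess_lipschitz f g (c : R) : continuous f -> continuous g ->
  (forall x, `|f x - g x| <= c) -> excess f <= excess g + 2 * c.
Proof.
move=> cf cg fg; apply: excess_le => // nu.
have := value_le_excess nu cg.
have near_mean rho : `|mean rho f - mean rho g| <= c.
  have cN : continuous (fun x => -1 * g x + f x).
    by move=> x; apply: cvgD; [apply: cvgM; [exact: cvg_cst|exact: cg]|exact: cf].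
  have := mean_linear XT rho (-1) cg cf; rewrite mulN1r addrC => <-.
  by apply: mean_bound => // x; rewrite mulN1r addrC.
have := near_mean nu; have := near_mean mu.
rewrite !ler_norml /value /v0 => /andP[? ?] /andP[? ?]; lra.
Qed.

(** The perturbation [t * (2 * g - 1)] changes the value at [nu] by
    [2 * t * (mean nu g - mean mu g)], where [mean mu g >= 3/4]. If [mean nu g < 1/8], the value
    drops by more than [t]. Otherwise it rises by at most [t / 2], but such measures start at least
    [3 * t] below the excess. *)
Lemma excess_descent f : continuous f -> 0 < excess f ->
  exists (t : R) (g : X -> R), [/\ 0 < t, continuous g,
    forall x, `|g x - f x| <= t & excess g <= excess f - t / 2].
Proof.
move=> cf; set J := excess f => J0.
have v0J nu : v0 f nu <= J.
  by apply: le_trans (value_le_excess nu cf); rewrite valueE le_max lexx.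
have v1J nu : v1 f nu <= J.
  by apply: le_trans (value_le_excess nu cf); rewrite valueE le_max lexx orbT.
have d0 : 0 < 8^-1 :> R by rewrite invr_gt0.
have v0mu : v0 f mu = 0 by rewrite /v0 subrr.
have v1mu : v1 f mu = 0 by rewrite /v1 v0mu k_mu addr0.
have [g0 [cg0 g001 mug0] g0P] :=
  affine_level_peak (usc_v0 cf) (aff_v0 cf) ext_mu v0mu v0J J0 d0.
have [g1 [cg1 g101 mug1] g1P] :=
  affine_level_peak (usc_v1 cf) (aff_v1 cf) ext_mu v1mu v1J J0 d0.
pose g x := Num.min (g0 x) (g1 x).
have cg : continuous g by exact: min_cont.
have g01 x : 0 <= g x <= 1.
  by rewrite /g le_min ge_min (andP (g001 x)).1 (andP (g001 x)).2 (andP (g101 x)).1.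
(* Both functions are at most 1, so their minimum is at least [g0 + g1 - 1], whose mean for [mu] is
   at least [1 - 2/8]. *)
have mug : 1 - 2 * 8^-1 <= mean mu g.
  have c2 : continuous (fun x => g0 x + (g1 x + -1)).
    move=> x; apply: cvgD; first exact: cg0.
    by apply: cvgD; [exact: cg1|exact: cvg_cst].
  have c3 : continuous (fun x => g1 x + -1).
    by move=> x; apply: cvgD; [exact: cg1|exact: cvg_cst].
  have : mean mu (fun x => g0 x + (g1 x + -1)) <= mean mu g.
    apply: mean_le => // x; have := g001 x; have := g101 x.
    by rewrite /g le_min => /andP[? ?] /andP[? ?]; apply/andP; split; lra.
  rewrite mean_add// mean_add//; last exact: cst_continuous.
  rewrite mean_cst; lra.
have gP nu : J <= v0 f nu \/ J <= v1 f nu -> mean nu g < 8^-1.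
  by move=> [/g0P|/g1P]; apply: le_lt_trans; apply: mean_le => // x;
    rewrite /g ge_min lexx ?orbT.
(* On [B] neither competitor reaches [J]; upper semi-continuity and compactness turn this into a
   uniform gap, from which [t] is chosen. *)
pose B : set M := [set nu | 8^-1 <= mean nu g].
have kB : compact B.
  apply: (subclosed_compact _ (compact_invariant_measures XT)) => //.
  apply: (@closed_comp _ _ (fun nu => mean nu g) [set r | 8^-1 <= r]) => [nu _|].
    exact: mean_continuous.
  exact: closed_ge.
have : \forall t \near 0^'+,
    B `<=` (fun nu => v0 f nu <= J - 3 * t /\ v1 f nu <= J - 3 * t).
  move/compact_near_coveringP : kB; apply => nu Bnu.
  have lt0 : v0 f nu < J.
    rewrite ltNge; apply/negP => h.
    by have := gP nu (or_introl h); rewrite ltNge Bnu.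
  have lt1 : v1 f nu < J.
    rewrite ltNge; apply/negP => h.
    by have := gP nu (or_intror h); rewrite ltNge Bnu.
  pose r := Num.max ((v0 f nu + J) / 2) ((v1 f nu + J) / 2).
  have rJ : r < J by rewrite gt_max; apply/andP; split; lra.
  have r0 : v0 f nu < r by rewrite lt_max; apply/orP; left; lra.
  have r1 : v1 f nu < r by rewrite lt_max; apply/orP; right; lra.
  exists ([set rho | v0 f rho < r /\ v1 f rho < r], [set t | t < (J - r) / 3]).
    split; last by apply: nbhs_right_lt; rewrite divr_gt0// subr_gt0.
    exact: filterS2 (usc_v0 cf r0) (usc_v1 cf r1).
  by move=> [rho t] /= [[? ?] ?]; split; lra.
move=> Bt.
have [t [t0 {}Bt]] : exists t : R, 0 < t /\
    B `<=` (fun nu => v0 f nu <= J - 3 * t /\ v1 f nu <= J - 3 * t).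
  by apply: (filter_ex (F := 0^'+)); apply: filterI => //; exact: nbhs_right_gt.
have cu : continuous (fun x => (2 * t) * g x + - t).
  by move=> x; apply: cvgD; [apply: cvgM; [exact: cvg_cst|exact: cg]|exact: cvg_cst].
have cG : continuous (fun x => f x + ((2 * t) * g x + - t)).
  by move=> x; apply: cvgD; [exact: cf|exact: cu].
(* The constant [- t] leaves all values unchanged and centres the perturbation, so that its uniform
   norm is at most [t] rather than [2 * t]. *)
exists t, (fun x => f x + ((2 * t) * g x + - t)); split => //.
  move=> x; rewrite [f x + _]addrC addrK; have /andP[g_ge0 g_le1] := g01 x.
  by rewrite ler_norml; apply/andP; split; nra.
have meanE nu : mean nu (fun x => f x + ((2 * t) * g x + - t)) =
    mean nu f + ((2 * t) * mean nu g - t).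
  rewrite mean_add// mean_linear// ?mean_cst//; exact: cst_continuous.
apply: excess_le => // nu.
have -> : value (fun x => f x + ((2 * t) * g x + - t)) nu =
    value f nu + 2 * t * (mean nu g - mean mu g).
  by rewrite /value /v0 !meanE; ring.
have mu_le1 : mean mu g <= 1.
  by rewrite -(mean_cst mu 1); apply: mean_le => //;
    [exact: cst_continuous|move=> x; have /andP[] := g01 x].
have nu_le1 : mean nu g <= 1.
  by rewrite -(mean_cst nu 1); apply: mean_le => //;
    [exact: cst_continuous|move=> x; have /andP[] := g01 x].
have [nug|nug] := ltP (mean nu g) 8^-1.
  have := value_le_excess nu cf; rewrite -/J; nra.
have [h0 h1] := Bt nu nug.
have : value f nu <= J - 3 * t by rewrite valueE ge_max h0 h1.
nra.
Qed.

Theorem perturb_to_maximizer f : continuous f ->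
  (forall nu, mean nu f <= mean mu f) -> exists g, [/\ continuous g,
    forall x, `|g x - f x| <= 2 * C
    & forall nu, mean nu g + Num.max 0 (k nu) <= mean mu g].
Proof.
move=> cf fmax.
have [g [cg gf g0]] := uniform_descent excess_ge0 excess_lipschitz excess_descent cf.
have fC : excess f <= C.
  apply: excess_le => // nu; have := fmax nu.
  have : Num.max 0 (k nu) <= C by rewrite ge_max C_ge0 k_le.
  by rewrite /value /v0; lra.
exists g; split => //.
  by move=> x; apply: le_trans (gf x) _; rewrite ler_pM2l.
by move=> nu; have := value_le_excess nu cg; rewrite g0 /value /v0; lra.
Qed.

End freezing.

Theorem theorem4 (R : realType) (X : pmetricType R) (G : topSemigroupType)
    (T : G -> X -> X) (h : invariant_measure T -> R)
    (XT : dynamical_system T)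
    (M0 : [set: invariant_measure T] !=set0)
    (h_ge0 : forall mu, 0 <= h mu)
    (h_affine : affine h)
    (h_fin : (topological_entropy h < +oo)%E)
    (h_usc : upper_semicontinuous h) :
  dense [set phi : potential X | freezes h phi].
Proof.
move=> O [phi Ophi] oO.
have [e /= e0 eO] : nbhs_ball phi O by rewrite nbhs_ballE; exact: open_nbhs_nbhs.
have cphi : continuous (phi : X -> R) by exact: cts_fun.
have [H hH] : exists H : R, forall mu, h mu <= H.
  exists (fine (topological_entropy h)) => mu.
  have hle nu : ((h nu)%:E <= topological_entropy h)%E.
    by apply: ereal_sup_ubound; exists nu.
  rewrite -lee_fin fineK ?hle// fin_numE.
  move: h_fin; rewrite ltey => ->; rewrite andbT.
  by apply/eqP => hN; have := hle mu; rewrite hN leeNy_eq.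
have [mu ext phimax] := extreme_maximizer XT cphi M0.
have H0 : 0 <= H by apply: le_trans (hH mu).
(* This gives [2 * (s * H) = e * H / (2 * (H + 1)) < e], so the perturbed potential stays in the
   ball; [H + 1] covers the case of zero entropy. *)
pose s := e / (4 * (H + 1)).
have s0 : 0 < s by rewrite divr_gt0// mulr_gt0// ltr_wpDl.
pose k nu := s * (h nu - h mu).
have usc_k : usc k.
  move=> nu r; rewrite /k mulrC -ltr_pdivlMr// ltrBlDr => hr.
  have [|V nV VP] := h_usc nu (- (r / s + h mu)); first by rewrite lte_fin ltrN2.
  apply: filterS nV => rho /VP; rewrite lte_fin ltrN2 => hrho.
  by rewrite mulrC -ltr_pdivlMr// ltrBlDr.
have aff_k : mixture_affine k.
  by move=> t nu1 nu2 rho t01 mix; rewrite /k (h_affine t nu1 nu2 rho t01 mix); ring.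
have k_mu : k mu = 0 by rewrite /k subrr mulr0.
have k_le nu : k nu <= s * H.
  by rewrite /k ler_pM2l//; have := hH nu; have := h_ge0 mu; lra.
have [g [cg gphi gmax]] :=
  perturb_to_maximizer XT usc_k aff_k k_mu k_le ext cphi phimax.
have sH : 2 * (s * H) < e.
  have -> : e = s * (4 * (H + 1)).
    by rewrite /s divfK// mulf_neq0// gt_eqF// ltr_wpDl.
  rewrite mulrCA ltr_pM2l//; lra.
exists (mkcts cg : potential X); split.
  have gball x : ball (phi x : R) e (g x).
    by apply: le_lt_trans sH; rewrite distrC; exact: gphi.
  by apply: eO; exact: gball.
(* The inequality for [g] bounds [h nu - h mu] by [d / s], where [d] is the gap of the means. Since
   [d >= 0], this is at most [beta * d] for every [beta >= 1 / s]. *)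
exists mu, s^-1; first by rewrite invr_gt0.
move=> beta beta_ge.
have b0 : 0 < beta by apply: lt_le_trans beta_ge; rewrite invr_gt0.
have meanZ (nu : invariant_measure T) :
    mean nu (fun x => beta * g x) = beta * mean nu g.
  have cz : continuous (fun _ : X => 0 : R) by exact: cst_continuous.
  have := mean_linear XT nu beta cg cz; rewrite mean_cst addr0 => <-.
  by congr (mean nu _); apply/funext => x; rewrite addr0.
rewrite /equilibrium_state /pressure; apply/eqP; rewrite eq_le; apply/andP; split.
  apply: ge_ereal_sup => _ [nu _ <-]; rewrite lee_fin.
  rewrite -!/(mean _ _) !meanZ.
  have := gmax nu; set d := mean mu g - mean nu g => gd.
  have d0 : 0 <= d.
    have : 0 <= Num.max 0 (k nu) by rewrite le_max lexx.
    by rewrite /d; lra.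
  have kd : s * (h nu - h mu) <= d.
    have : k nu <= Num.max 0 (k nu) by rewrite le_max lexx orbT.
    by rewrite /d /k; lra.
  have : h nu - h mu <= beta * d.
    apply: (@le_trans _ _ (s^-1 * d)); last by rewrite ler_wpM2r.
    by rewrite mulrC ler_pdivlMr// mulrC.
  rewrite /d; lra.
by apply: ereal_sup_ubound; exists mu.
Qed.
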